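(* Let $h:T^*M\to\mathcal D$ be a sub-Riemannian geometry with surjective Levi form $L:\mathcal D\times\mathcal D\to\mathcal Q=TM/\mathcal D$. If the bundle map $$ \mathcal Q^*\otimes\mathcal D\ni f_a^j\mapsto \tfrac12\bigl(f_a^\ell L_{bi\ell}+f_b^\ell L_{ai\ell}\bigr)L^a_{jk}h^{ik}\in\mathcal Q^*\otimes\mathcal D^* $$ is injective, then there exists a canonical Riemannian metric $g$ on $TM$ that extends $h$ on $\mathcal D$. In particular, there is such a canonical metric for contact distributions, and also for free distributions with $\operatorname{rank}(\mathcal D)\neq 3$.
   Context: All manifolds are smooth, connected and finite dimensional, and all tensors are smooth. A sub-Riemannian geometry is a smooth manifold $M$ with a symmetric contravariant 2-tensor $h$ such that the image $\mathcal D$ of $h:T^*M\to TM$ is a bracket generating distribution of constant rank, and the metric on $\mathcal D$ induced by $h$ (also denoted $h$) is positive definite. Put $\mathcal Q=TM/\mathcal D$ with projection $q:TM\to\mathcal Q$. The Levi form is the tensor $L(X,Y)=q([X,Y])$ for $X,Y\in\mathcal D$. It is called surjective if the induced linear bundle map $\mathcal D\wedge\mathcal D\to\mathcal Q$ is surjective. Metric on $\mathcal Q$: when $L$ is surjective, $\mathcal Q$ is identified with the orthogonal complement of the kernel of $\mathcal D\wedge\mathcal D\to\mathcal Q$, with respect to the metric on $\mathcal D\wedge\mathcal D$ induced by $h$. This gives $\mathcal Q$ a metric, denoted $h_{ab}$. Index notation (summation convention): $i,j,k,\ell$ are $\mathcal D$-indices and $a,b$ are $\mathcal Q$-indices. $L^a_{jk}$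 is the Levi form, $L_{aij}=h_{ab}L^b_{ij}$, and $h^{ik}$ is the inverse of the metric $h$ on $\mathcal D$. The map is required to be injective in the fibre over every point of $M$. ''Canonical'' means determined by the sub-Riemannian structure alone, without further choices: the construction assigns to each such structure $(M,h)$ a metric $g_{(M,h)}$ in such a way that $\varphi^*g_{(M',h')}=g_{(M,h)}$ for every open embedding $\varphi:M\to M'$ intertwining the sub-Riemannian structures $h$ and $h'$. The distribution $\mathcal D$ is contact if $\mathcal Q$ has rank one and $L$ is non-degenerate at each point. It is free if $L$ induces an isomorphism $\mathcal D\wedge\mathcal D\to\mathcal Q$ (so $\dim M=\frac12n(n+1)$ for $n=\operatorname{rank}\mathcal D$). *)

(* Defs.v *)
From HB Require Import structures.
From mathcomp Require Import all_boot all_order all_algebra.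
From mathcomp Require Import all_classical all_reals all_analysis.

Set Implicit Arguments.
Unset Strict Implicit.
Unset Printing Implicit Defensive.

Import Order.TTheory GRing.Theory Num.Theory.
Import numFieldNormedType.Exports.
Local Open Scope classical_set_scope.
Local Open Scope ring_scope.

(* [V] is meant to be open. *)
Fixpoint Ck_on (R : realType) (U W : normedModType R) (k : nat) (V : set U)
    (f : U -> W) : Prop :=
  match k with
  | 0%N => forall x, V x -> {for x, continuous f}
  | k'.+1 => (forall x, V x -> differentiable f x) /\
             (forall v, Ck_on k' V ('D_v f))
  end.

Definition smooth_on (R : realType) (U W : normedModType R) (V : set U)
  (f : U -> W) : Prop := forall k, Ck_on k V f.

Definition lie_bracket (R : realType) (n : nat) (X Y : 'rV[R]_n -> 'rV[R]_n)
    (x : 'rV[R]_n) : 'rV[R]_n :=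
  'D_(X x) Y x - 'D_(Y x) X x.

(* The maps are total; only [cmap] on [cdom] and [cinv] on [cimg] matter. *)
Record chart (R : realType) (T : topologicalType) (n : nat) := Chart {
  cdom : set T;
  cmap : T -> 'rV[R]_n;
  cinv : 'rV[R]_n -> T }.

Definition cimg (R : realType) (T : topologicalType) (n : nat)
  (c : chart R T n) : set 'rV[R]_n := cmap c @` cdom c.

Definition is_chart (R : realType) (T : topologicalType) (n : nat)
    (c : chart R T n) : Prop :=
  [/\ open (cdom c), open (cimg c),
      forall p, cdom c p -> cinv c (cmap c p) = p,
      forall p, cdom c p -> {for p, continuous (cmap c)}
    & forall x, cimg c x -> {for x, continuous (cinv c)}].

(* A space with a (not necessarily maximal) set of charts. *)
Record charted (R : realType) := Charted {
  carrier :> topologicalType;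
  dim : nat;
  atlas : set (chart R carrier dim) }.

Section Maps.
Variables (R : realType) (M N : charted R).

Definition local_rep (c : chart R M (dim M)) (d : chart R N (dim N))
  (F : M -> N) : 'rV[R]_(dim M) -> 'rV[R]_(dim N) :=
  cmap d \o F \o cinv c.

(* [A] is meant to be open. *)
Definition smooth_map (A : set M) (F : M -> N) : Prop :=
  (forall p, A p -> {for p, continuous F}) /\
  (forall c d, atlas c -> atlas d ->
     smooth_on (cmap c @` (A `&` cdom c `&` F @^-1` cdom d)) (local_rep c d F)).

End Maps.

(* Diffeomorphism onto an open subset. *)
Definition open_embedding (R : realType) (M N : charted R) (F : M -> N) : Prop :=
  [/\ smooth_map setT F, open (range F)
    & exists G : N -> M, cancel F G /\ smooth_map (range F) G].

(* Smoothness of [idfun] is the smooth compatibility of the charts. *)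
Definition is_manifold (R : realType) (M : charted R) : Prop :=
  [/\ hausdorff_space M, @second_countable M, connected [set: M],
      (forall c : chart R M (dim M), atlas c -> is_chart c) /\
      (forall p : M, exists2 c : chart R M (dim M), atlas c & cdom c p)
    & @smooth_map R M M setT idfun].

(* [T c x] is the component matrix, in the chart [c], at the point with
   coordinates [x]; it matters only for [atlas c] and [cimg c x]. *)
Definition tensor2 (R : realType) (M : charted R) : Type :=
  chart R M (dim M) -> 'rV[R]_(dim M) -> 'M[R]_(dim M).

(* Tangent vectors are row vectors, so the differential of [f] at [x] is
   [v |-> v *m jacobian f x]. *)
Definition contra_related (R : realType) (M N : charted R) (F : M -> N)
    (h : tensor2 M) (h' : tensor2 N) : Prop :=
  forall (c : chart R M (dim M)) (d : chart R N (dim N)) (p : M),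
    atlas c -> atlas d -> cdom c p -> cdom d (F p) ->
    let J := jacobian (local_rep c d F) (cmap c p) in
    h' d (cmap d (F p)) = J^T *m h c (cmap c p) *m J.

(* [g] is the pullback of [g'] along [F]. *)
Definition is_pullback (R : realType) (M N : charted R) (F : M -> N)
    (g : tensor2 M) (g' : tensor2 N) : Prop :=
  forall (c : chart R M (dim M)) (d : chart R N (dim N)) (p : M),
    atlas c -> atlas d -> cdom c p -> cdom d (F p) ->
    let J := jacobian (local_rep c d F) (cmap c p) in
    g c (cmap c p) = J *m g' d (cmap d (F p)) *m J^T.

Definition smooth_tensor (R : realType) (M : charted R) (T : tensor2 M) : Prop :=
  forall c : chart R M (dim M), atlas c -> smooth_on (cimg c) (T c).

(* With [F := idfun] the two relations above are the transformation laws under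
   a change of chart. *)
Definition contra_tensor (R : realType) (M : charted R) (h : tensor2 M) : Prop :=
  smooth_tensor h /\ contra_related idfun h h.

Definition cov_tensor (R : realType) (M : charted R) (g : tensor2 M) : Prop :=
  smooth_tensor g /\ is_pullback idfun g g.

Definition riemannian_metric (R : realType) (M : charted R) (g : tensor2 M) :
    Prop :=
  cov_tensor g /\
  forall (c : chart R M (dim M)) x, atlas c -> cimg c x ->
    (g c x)^T = g c x /\ (forall v : 'rV_(dim M), v != 0 -> 0 < (v *m g c x *m v^T) 0 0).

(* A matrix [H] stands for the map [h : T^*M -> TM], [a |-> a *m H]; its image
   [D] is the row space of [H].  The metric that [h] induces on [D] sends
   [X = h a] and [Y = h b] to [h (a, b) = a Y]; [X *m pinvmx H] is such an
   [a]. *)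
Definition hmetric (R : realType) (n : nat) (H : 'M[R]_n) (X Y : 'rV[R]_n) : R :=
  (X *m pinvmx H *m Y^T) 0 0.

(* Iterated brackets over [V] of smooth sections of the image of [H]. *)
Inductive iterated_bracket (R : realType) (n : nat) (H : 'rV[R]_n -> 'M[R]_n)
    (V : set 'rV[R]_n) : ('rV[R]_n -> 'rV[R]_n) -> Prop :=
| Iter_section X : smooth_on V X -> (forall y, V y -> (X y <= H y)%MS) ->
    iterated_bracket H V X
| Iter_bracket X Y : iterated_bracket H V X -> iterated_bracket H V Y ->
    iterated_bracket H V (lie_bracket X Y).

Definition bracket_generating_at (R : realType) (n : nat)
    (H : 'rV[R]_n -> 'M[R]_n) (x : 'rV[R]_n) : Prop :=
  exists V, open_nbhs x V /\
  exists r (X : 'I_r -> 'rV[R]_n -> 'rV[R]_n),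
    (forall i, iterated_bracket H V (X i)) /\ row_full (\matrix_i X i x).

Record is_subriemannian (R : realType) (M : charted R) (h : tensor2 M)
    (k : nat) : Prop := IsSubRiemannian {
  sr_manifold : is_manifold M;
  sr_tensor : contra_tensor h;
  sr_sym : forall (c : chart R M (dim M)) x, atlas c -> cimg c x ->
    (h c x)^T = h c x;
  sr_const_rank : forall (c : chart R M (dim M)) x, atlas c -> cimg c x ->
    \rank (h c x) = k;
  sr_posdef : forall (c : chart R M (dim M)) x X, atlas c -> cimg c x ->
    (X <= h c x)%MS -> X != 0 -> 0 < hmetric (h c x) X X;
  sr_generating : forall (c : chart R M (dim M)) x, atlas c -> cimg c x ->
    bracket_generating_at (h c) x }.

Record subRiemannian (R : realType) := SubRiemannian {
  sr_mfd :> charted R;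
  sr_h : tensor2 sr_mfd;
  sr_rank : nat;
  sr_axioms : is_subriemannian sr_h sr_rank }.

Definition extends_metric (R : realType) (S : subRiemannian R) (g : tensor2 S) :
    Prop :=
  forall (c : chart R S (dim S)) x X Y, atlas c -> cimg c x ->
    (X <= sr_h c x)%MS -> (Y <= sr_h c x)%MS ->
    (X *m g c x *m Y^T) 0 0 = hmetric (sr_h c x) X Y.

(* [E] is a local frame of D near [x] (its rows are the vector fields e_i), and
   the classes modulo D of the rows of [U] form a basis of Q at [x]. *)
Definition adapted_frame (R : realType) (n : nat) (H : 'rV[R]_n -> 'M[R]_n)
    (x : 'rV[R]_n) (k m : nat) (E : 'rV[R]_n -> 'M[R]_(k, n)) (U : 'M[R]_(m, n)) :
    Prop :=
  [/\ exists V, [/\ open_nbhs x V, smooth_on V E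
                  & forall y, V y -> row_free (E y) /\ (E y == H y)%MS],
      row_free (col_mx (E x) U)
    & (k + m)%N = n].

(* [L a i j] is the component L^a_ij: modulo D, [e_i, e_j] = L^a_ij u_a. *)
Definition levi_components (R : realType) (n : nat) (H : 'rV[R]_n -> 'M[R]_n)
    (x : 'rV[R]_n) (k m : nat) (E : 'rV[R]_n -> 'M[R]_(k, n)) (U : 'M[R]_(m, n))
    (L : 'I_m -> 'I_k -> 'I_k -> R) : Prop :=
  forall i j,
    (lie_bracket (fun y => row i (E y)) (fun y => row j (E y)) x
       - \sum_a L a i j *: row a U <= H x)%MS.

Definition gram (R : realType) (n : nat) (H : 'M[R]_n) (k : nat)
    (E : 'M[R]_(k, n)) : 'M[R]_k :=
  \matrix_(i, j) hmetric H (row i E) (row j E).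

Section FrameAlgebra.
Variables (R : realType) (k m : nat).
Implicit Types (hD w : 'M[R]_k) (L : 'I_m -> 'I_k -> 'I_k -> R).

(* An antisymmetric [w] stands for 1/2 w^ij e_i /\ e_j. *)
Definition antisym w : Prop := w^T = - w.

(* The map from the second exterior power of D to Q induced by the Levi form. *)
Definition levi_wedge L w : 'rV[R]_m :=
  \row_a (2^-1 * \sum_i \sum_j L a i j * w i j).

(* Induced by <X /\ Y, Z /\ W> = h(X,Z) h(Y,W) - h(X,W) h(Y,Z). *)
Definition wedge_metric hD (w w' : 'M[R]_k) : R :=
  2^-1 * \sum_i \sum_j \sum_i' \sum_j' hD i i' * hD j j' * w i j * w' i' j'.

Definition levi_ker_orth hD L w : Prop :=
  antisym w /\
  forall z, antisym z -> levi_wedge L z = 0 -> wedge_metric hD w z = 0.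

(* For surjective L: the metric h_ab on Q for which [levi_wedge], restricted to
   the orthogonal complement of its kernel, is an isometry onto Q. *)
Definition Qmetric hD L (hQ : 'M[R]_m) : Prop :=
  forall w w', levi_ker_orth hD L w -> levi_ker_orth hD L w' ->
    (levi_wedge L w *m hQ *m (levi_wedge L w')^T) 0 0 = wedge_metric hD w w'.

Definition levi_low L (hQ : 'M[R]_m) (a : 'I_m) (i j : 'I_k) : R :=
  \sum_b hQ a b * L b i j.

(* [f a l] is f_a^l, and the entry [(b, j)] of the value is its component with
   lower indices b and j. *)
Definition bundle_map hD L (hQ : 'M[R]_m) (f : 'M[R]_(m, k)) : 'M[R]_(m, k) :=
  \matrix_(b, j) (\sum_a \sum_i \sum_k' \sum_l
    2^-1 * (f a l * levi_low L hQ b i l + f b l * levi_low L hQ a i l)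
      * L a j k' * (invmx hD) i k').

Definition levi_surjective_frame hD L : Prop :=
  forall v, exists2 w, antisym w & levi_wedge L w = v.

Definition bundle_map_injective_frame hD L : Prop :=
  forall hQ, Qmetric hD L hQ -> injective (bundle_map hD L hQ).

Definition contact_frame hD L : Prop :=
  m = 1%N /\
  forall X : 'rV[R]_k,
    (forall a (Y : 'rV[R]_k), \sum_i \sum_j L a i j * X 0 i * Y 0 j = 0) ->
    X = 0.

Definition free_frame hD L : Prop :=
  forall v, exists! w, antisym w /\ levi_wedge L w = v.

End FrameAlgebra.

(* [P], a property of the components of h and L, holds in every fibre.  The
   properties used below do not depend on the frame. *)
Definition fibrewise (R : realType) (S : subRiemannian R)
    (P : forall k m, 'M[R]_k -> ('I_m -> 'I_k -> 'I_k -> R) -> Prop) : Prop :=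
  forall (c : chart R S (dim S)) x, atlas c -> cimg c x ->
  forall k m (E : 'rV[R]_(dim S) -> 'M[R]_(k, dim S)) (U : 'M[R]_(m, dim S))
    (L : 'I_m -> 'I_k -> 'I_k -> R),
    adapted_frame (sr_h c) x E U -> levi_components (sr_h c) x E U L ->
    P k m (gram (sr_h c x) (E x)) L.

Definition levi_surjective (R : realType) (S : subRiemannian R) : Prop :=
  fibrewise S (@levi_surjective_frame R).

Definition bundle_map_injective (R : realType) (S : subRiemannian R) : Prop :=
  fibrewise S (@bundle_map_injective_frame R).

Definition contact (R : realType) (S : subRiemannian R) : Prop :=
  fibrewise S (@contact_frame R).

Definition free_distribution (R : realType) (S : subRiemannian R) : Prop :=
  fibrewise S (@free_frame R).

(* [g] assigns to every structure in the class [C], naturally, a Riemannian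
   metric extending that of the distribution. *)
Definition canonical_extension (R : realType) (C : subRiemannian R -> Prop)
    (g : forall S : subRiemannian R, tensor2 S) : Prop :=
  (forall S, C S -> riemannian_metric (g S) /\ extends_metric (g S)) /\
  (forall (S S' : subRiemannian R) (F : S -> S'), C S -> C S' ->
     open_embedding F -> contra_related F (@sr_h R S) (@sr_h R S') ->
     is_pullback F (g S) (g S')).

(* Main.v *)
(* A complement of D in TM defines a partial connection X, u |-> q([X, u]) on Q in
   the directions X of D, hence a derivative nabla_i h_ab of the metric of Q.
   Adding f : Q -> D to the complement changes nabla_i h_ab by
   - f_a^l L_bil - f_b^l L_ail, so the trace nabla_i h_ab L^a_jk h^ik changes by a
   multiple of the bundle map of the statement.  When that map is injective,
   exactly one complement makes the trace vanish, and the metric is the orthogonal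
   sum of h on D and h_ab on this complement.  Dually, for a coframe theta^a of the
   annihilator of D everything is expressed by the values of h and d theta^a, the
   derivative of h^ab and the complement at a single point: the complement solves a
   linear system at each point, depending smoothly on the point, and naturality
   follows from the naturality of d and the uniqueness of the solution. *)

From HB Require Import structures.
Require Import Defs.
From mathcomp Require Import all_boot all_order all_algebra.
From mathcomp Require Import all_classical all_reals all_analysis.
From mathcomp Require Import ring.

Set Implicit Arguments.
Unset Strict Implicit.
Unset Printing Implicit Defensive.

Import Order.TTheory GRing.Theory Num.Theory.
Import numFieldNormedType.Exports.
Local Open Scope classical_set_scope.
Local Open Scope ring_scope.

(** The hypotheses are stated in frames of D and the construction uses coframes, because forms pull
    back along a map together with their exterior derivatives; this is where the symmetry of second
    derivatives enters. The two sides are linked by d theta(X, Y) = - theta([X, Y]) on D.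

    The delicate point is independence of the coframe. When theta is replaced by theta A,
    derivatives of A enter both the derivative of h^ab and d theta. They cancel in the derivative of
    the cometric of Q because the complement is normalised by [V *m th = cometric H T]; this is why
    it is encoded by the vectors h^ab u_b, for which the equation is moreover affine.

    Uniqueness also replaces gluing: [canonical_metric] picks, at every point of every chart, some
    matrix satisfying [canonical_at]. Smoothness follows by comparison with a local solution, and
    the tensor law is naturality along the identity. *)

(** * Calculus of smooth maps *)

Section Smooth.
Variables (R : realType) (U : normedModType R).
Implicit Types (V : set U).

Lemma near_eq_differentiable (W : normedModType R) (f g : U -> W) x :
  (\forall y \near x, f y = g y) -> differentiable f x -> differentiable g x.
Proof.
move=> fg df; have [dfc dfo] := (diff_locallyP x f).1 df.
have gE : g \o shift x = cst (g x) + 'd f x +o_ 0 id.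
  apply/eqaddoE/eqaddoP => e e0.
  move/eqaddoP: dfo => /(_ e e0).
  have : \forall h \near 0, f (h + x) = g (h + x).
    by move: fg; rewrite (near_shift 0)/=; apply: filterS => h; rewrite subr0.
  apply: filterS2 => h.
  rewrite /= !fctE /= => ->.
  by rewrite (nbhs_singleton fg).
apply/diff_locallyP; have := diff_unique dfc gE.
by move=> ->.
Qed.

(** Maps are total and derivatives are taken in the whole space, so the values off [V] must be shown
    to be irrelevant: as [V] is open, the two maps agree near each of its points, and so do their
    derivatives. *)
Lemma Ck_on_eq (W : normedModType R) k V (f g : U -> W) : open V ->
  (forall x, V x -> f x = g x) -> Ck_on k V f -> Ck_on k V g.
Proof.
move=> oV; elim: k f g => [|k IH] f g fg /=.
  move=> cf x Vx; have fgx : \forall y \near x, f y = g y.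
    by near=> y; apply: fg; near: y; exact: open_nbhs_nbhs.
  change (g @ x --> g x); rewrite -(fg x Vx); apply: cvg_trans (cf x Vx).
  exact: near_eq_cvg.
case=> df Df; split=> [x Vx|v].
  apply: near_eq_differentiable (df x Vx).
  by near=> y; apply: fg; near: y; exact: open_nbhs_nbhs.
apply: (IH _ _ _ (Df v)) => x Vx; apply: near_eq_derive.
by near=> y; apply: fg; near: y; exact: open_nbhs_nbhs.
Unshelve. all: by end_near. Qed.

Lemma Ck_on_subset (W : normedModType R) k V V' (f : U -> W) : V' `<=` V ->
  Ck_on k V f -> Ck_on k V' f.
Proof.
move=> sV; elim: k f => [|k IH] f /=; first by move=> cf x /sV /cf.
by case=> df Df; split=> [x /sV/df//|v]; exact: IH (Df v).
Qed.

Lemma Ck_onW (W : normedModType R) k V (f : U -> W) :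
  Ck_on k.+1 V f -> Ck_on k V f.
Proof.
elim: k f => [|k IH] f.
  by case=> df _ x /df; exact: differentiable_continuous.
by case=> df Df; split=> // v; exact: IH (Df v).
Qed.

Lemma Ck_on_cst (W : normedModType R) k V (a : W) : Ck_on k V (fun=> a).
Proof.
elim: k a => [|k IH] a /=; first by move=> x _; exact: cst_continuous.
split=> [x _|v]; first exact: differentiable_cst.
have -> : 'D_v (fun=> a : W) = (fun _ : U => 0 : W); last exact: IH.
by apply/funext => x; exact: derive_cst.
Qed.

Lemma Ck_onD (W : normedModType R) k V (f g : U -> W) : open V ->
  Ck_on k V f -> Ck_on k V g -> Ck_on k V (fun x => f x + g x).
Proof.
move=> oV; elim: k f g => [|k IH] f g /=.
  by move=> cf cg x Vx; apply: continuousD; [exact: cf|exact: cg].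
move=> [df Df] [dg Dg]; split=> [x Vx|v].
  by apply: differentiableD; [exact: df|exact: dg].
apply: (Ck_on_eq oV _ (IH _ _ (Df v) (Dg v))) => x Vx.
by rewrite -deriveD //; apply: diff_derivable; [exact: df|exact: dg].
Qed.

Lemma Ck_on_sum (W : normedModType R) k V (I : Type) (r : seq I) (P : pred I)
    (f : I -> U -> W) : open V ->
  (forall i, P i -> Ck_on k V (f i)) -> Ck_on k V (fun x => \sum_(i <- r | P i) f i x).
Proof.
move=> oV cf; elim: r => [|i r IH].
  have -> : (fun x => \sum_(i <- [::] | P i) f i x) = (fun=> 0).
    by apply/funext => x; rewrite big_nil.
  exact: Ck_on_cst.
have [Pi|Pi] := boolP (P i); last first.
  by apply: (Ck_on_eq oV _ IH) => x _; rewrite big_cons (negbTE Pi).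
apply: (Ck_on_eq oV _ (Ck_onD oV (cf i Pi) IH)) => x _.
by rewrite big_cons Pi.
Qed.

Lemma Ck_onM k V (f g : U -> R) : open V ->
  Ck_on k V f -> Ck_on k V g -> Ck_on k V (fun x => f x * g x).
Proof.
move=> oV; elim: k f g => [|k IH] f g.
  by move=> cf cg x Vx; apply: continuousM; [exact: cf|exact: cg].
move=> cf cg; have [[df Df] [dg Dg]] := (cf, cg); split=> [x Vx|v].
  by apply: differentiableM; [exact: df|exact: dg].
apply: (Ck_on_eq oV _ (Ck_onD oV (IH _ _ (Ck_onW cf) (Dg v))
                                 (IH _ _ (Ck_onW cg) (Df v)))) => x Vx.
by rewrite [in RHS]deriveM //; apply: diff_derivable; [exact: df|exact: dg].
Qed.

Lemma Ck_onN (W : normedModType R) k V (f : U -> W) : open V ->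
  Ck_on k V f -> Ck_on k V (fun x => - f x).
Proof.
move=> oV; elim: k f => [|k IH] f.
  by move=> cf x Vx; apply: continuousN; exact: cf.
move=> [df Df]; split=> [x Vx|v]; first by apply: differentiableN; exact: df.
apply: (Ck_on_eq oV _ (IH _ (Df v))) => x Vx.
by rewrite -deriveN //; apply: diff_derivable; exact: df.
Qed.

Lemma Ck_onV k V (f : U -> R) : open V ->
  (forall x, V x -> f x != 0) -> Ck_on k V f -> Ck_on k V (fun x => (f x)^-1).
Proof.
move=> oV f0; elim: k => [|k IH].
  by move=> cf x Vx; apply: continuousV; [exact: f0|exact: cf].
move=> cf; have [df Df] := cf; split=> [x Vx|v].
  by apply: differentiableV; [exact: df|exact: f0].
(* The derivative is - f^-2 Df, and the induction hypothesis covers the factors f^-1, which need one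
   derivative less. *)
have /IH ci := Ck_onW cf.
apply: (Ck_on_eq oV _ (Ck_onN oV (Ck_onM oV (Ck_onM oV ci ci) (Df v)))) => x Vx.
rewrite deriveV ?f0 //; last by apply: diff_derivable; exact: df.
by rewrite scaleNr expr2 invfM.
Qed.

Lemma Ck_onZl (W : normedModType R) k V (f : U -> R) (a : W) : open V ->
  Ck_on k V f -> Ck_on k V (fun x => f x *: a).
Proof.
move=> oV; elim: k f => [|k IH] f.
  move=> cf x Vx.
  exact: (continuous_comp (cf x Vx) (@scalel_continuous _ _ a (f x))).
move=> [df Df]; split=> [x Vx|v]; first by apply: differentiableZl; exact: df.
apply: (Ck_on_eq oV _ (IH _ (Df v))) => x Vx.
rewrite deriveE ?[in RHS]deriveE ?diffZl//; last exact: df.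
  exact: df.
by apply: differentiableZl; exact: df.
Qed.

Lemma derive_coord m n (f : U -> 'M[R]_(m, n)) x v i j : differentiable f x ->
  'D_v f x i j = 'D_v (fun y => f y i j) x.
Proof. by move=> /diff_derivable df; rewrite derive_mx ?mxE. Qed.

Lemma Ck_on_coord m n k V (f : U -> 'M[R]_(m, n)) i j : open V ->
  Ck_on k V f -> Ck_on k V (fun x => f x i j).
Proof.
move=> oV; elim: k f => [|k IH] f.
  move=> cf x Vx.
  exact: (continuous_comp (cf x Vx) (@coord_continuous _ _ _ i j (f x))).
move=> [df Df]; split=> [x Vx|v].
  exact: (differentiable_comp (df _ Vx) (differentiable_coord _ i j)).
apply: (Ck_on_eq oV _ (IH _ (Df v))) => x Vx.
by rewrite derive_coord //; exact: df.
Qed.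

(** A matrix is the sum of its entries times constant matrices. Smoothness of all matrix operations
    thus reduces to sums and products of scalar functions. *)
Lemma Ck_on_mx m n k V (f : U -> 'M[R]_(m, n)) : open V ->
  (forall i j, Ck_on k V (fun x => f x i j)) -> Ck_on k V f.
Proof.
move=> oV cf.
have : Ck_on k V (fun x => \sum_i \sum_j f x i j *: delta_mx i j).
  by apply: Ck_on_sum => // i _; apply: Ck_on_sum => // j _; exact: Ck_onZl.
by apply: Ck_on_eq => // x _; rewrite -matrix_sum_delta.
Qed.

Lemma Ck_on_derive (W : normedModType R) k V (f : U -> W) v :
  Ck_on k.+1 V f -> Ck_on k V ('D_v f).
Proof. by move=> [_ Df]; exact: Df. Qed.

Lemma Ck_on_prod k V (I : Type) (r : seq I) (P : pred I) (f : I -> U -> R) :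
  open V -> (forall i, P i -> Ck_on k V (f i)) ->
  Ck_on k V (fun x => \prod_(i <- r | P i) f i x).
Proof.
move=> oV cf; elim: r => [|i r IH].
  have -> : (fun x => \prod_(i <- [::] | P i) f i x) = (fun=> 1).
    by apply/funext => x; rewrite big_nil.
  exact: Ck_on_cst.
have [Pi|Pi] := boolP (P i); last first.
  by apply: (Ck_on_eq oV _ IH) => x _; rewrite big_cons (negbTE Pi).
apply: (Ck_on_eq oV _ (Ck_onM oV (cf i Pi) IH)) => x _.
by rewrite big_cons Pi.
Qed.

Lemma Ck_on_mulmx m n p k V (f : U -> 'M[R]_(m, n)) (g : U -> 'M[R]_(n, p)) :
  open V -> Ck_on k V f -> Ck_on k V g -> Ck_on k V (fun x => f x *m g x).
Proof.
move=> oV cf cg; apply: Ck_on_mx => // i j.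
have : Ck_on k V (fun x => \sum_l f x i l * g x l j).
  apply: Ck_on_sum => // l _; apply: Ck_onM => //; exact: Ck_on_coord.
by apply: Ck_on_eq => // x _; rewrite mxE.
Qed.

Lemma Ck_on_tr m n k V (f : U -> 'M[R]_(m, n)) :
  open V -> Ck_on k V f -> Ck_on k V (fun x => (f x)^T).
Proof.
move=> oV cf; apply: Ck_on_mx => // i j.
have := Ck_on_coord j i oV cf.
by apply: Ck_on_eq => // x _; rewrite mxE.
Qed.

Lemma Ck_on_mxtrace n k V (f : U -> 'M[R]_n) :
  open V -> Ck_on k V f -> Ck_on k V (fun x => \tr (f x)).
Proof. by move=> oV cf; apply: Ck_on_sum => // i _; exact: Ck_on_coord. Qed.

Lemma Ck_on_det n k V (f : U -> 'M[R]_n) :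
  open V -> Ck_on k V f -> Ck_on k V (fun x => \det (f x)).
Proof.
move=> oV cf; apply: Ck_on_sum => // s _; apply: Ck_onM => //.
  exact: Ck_on_cst.
by apply: Ck_on_prod => // i _; exact: Ck_on_coord.
Qed.

Lemma Ck_on_adj n k V (f : U -> 'M[R]_n) :
  open V -> Ck_on k V f -> Ck_on k V (fun x => \adj (f x)).
Proof.
move=> oV cf; apply: Ck_on_mx => // i j.
have : Ck_on k V (fun x => (-1) ^+ (j + i) * \det (row' j (col' i (f x)))).
  apply: Ck_onM => //; first exact: Ck_on_cst.
  apply: Ck_on_det => //; apply: Ck_on_mx => // a b.
  have := Ck_on_coord (lift j a) (lift i b) oV cf.
  by apply: Ck_on_eq => // x _; rewrite !mxE.
by apply: Ck_on_eq => // x _; rewrite mxE.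
Qed.

(** By Cramer's rule the entries of the inverse are rational functions of the entries, with the
    determinant as denominator. *)
Lemma Ck_on_invmx n k V (f : U -> 'M[R]_n) : open V ->
  (forall x, V x -> f x \in unitmx) -> Ck_on k V f ->
  Ck_on k V (fun x => invmx (f x)).
Proof.
move=> oV uf cf; apply: Ck_on_mx => // i j.
have : Ck_on k V (fun x => (\det (f x))^-1 * \adj (f x) i j).
  apply: Ck_onM => //.
    apply: Ck_onV => // [x /uf|]; first by rewrite unitmxE unitfE.
    exact: Ck_on_det.
  by apply: Ck_on_coord => //; exact: Ck_on_adj.
by apply: Ck_on_eq => // x Vx; rewrite /invmx uf // [RHS]mxE.
Qed.

End Smooth.

(** * Chain rule, and derivatives of matrix products *)

Section Composition.
Variable R : realType.

Lemma derive_sum_coord m (W : normedModType R) (f : 'rV[R]_m -> W) x v :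
  differentiable f x -> 'D_v f x = \sum_i v 0 i *: 'D_(delta_mx 0 i) f x.
Proof.
move=> df; rewrite [LHS]deriveE // {1}(row_sum_delta v) linear_sum.
by apply: eq_bigr => i _; rewrite linearZ /= deriveE.
Qed.

(** Expanded in partial derivatives of [g], the chain rule expresses the derivative of the composite
    as a finite sum of products of scalar functions, to which the induction hypothesis applies. *)
Lemma Ck_on_comp_scalar (U : normedModType R) m k (V : set U)
    (V' : set 'rV[R]_m) (f : U -> 'rV[R]_m) (g : 'rV[R]_m -> R) : open V ->
  (forall x, V x -> V' (f x)) -> Ck_on k V f -> Ck_on k V' g ->
  Ck_on k V (g \o f).
Proof.
move=> oV fV; elim: k g => [|k IH] g.
  by move=> cf cg x Vx; apply: continuous_comp; [exact: cf|exact/cg/fV].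
move=> cf [dg Dg]; have [df Df] := cf; split=> [x Vx|v].
  by apply: differentiable_comp; [exact: df|exact/dg/fV].
have : Ck_on k V (fun x => \sum_i 'D_v f x 0 i * ('D_(delta_mx 0 i) g \o f) x).
  apply: Ck_on_sum => // i _; apply: Ck_onM => //.
    by apply: Ck_on_coord => //; exact: Df.
  by apply: IH; [exact: Ck_onW|exact: Dg].
apply: Ck_on_eq => // x Vx.
have Vfx := fV _ Vx.
have dgx : differentiable g (f x) by apply: dg.
have dfx : differentiable f x by apply: df.
rewrite [RHS]deriveE; last exact: differentiable_comp.
rewrite [in RHS]diff_comp //=.
by rewrite -(deriveE v dfx) -(deriveE _ dgx) (derive_sum_coord _ dgx).
Qed.

Lemma Ck_on_comp (U : normedModType R) m p q k (V : set U)
    (V' : set 'rV[R]_m) (f : U -> 'rV[R]_m) (g : 'rV[R]_m -> 'M[R]_(p, q)) :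
  open V -> open V' ->
  (forall x, V x -> V' (f x)) -> Ck_on k V f -> Ck_on k V' g ->
  Ck_on k V (g \o f).
Proof.
move=> oV oV' fV cf cg; apply: Ck_on_mx => // i j.
apply: (Ck_on_comp_scalar oV fV cf (g := fun y => g y i j)).
exact: Ck_on_coord.
Qed.

Lemma derive_mulmx (U : normedModType R) m n p (f : U -> 'M[R]_(m, n))
    (g : U -> 'M[R]_(n, p)) x v : differentiable f x -> differentiable g x ->
  'D_v (fun y => f y *m g y) x = 'D_v f x *m g x + f x *m 'D_v g x.
Proof.
move=> df dg.
have df' i j : derivable (fun y => f y i j) x v.
  exact/diff_derivable/(differentiable_comp df (differentiable_coord _ i j)).
have dg' i j : derivable (fun y => g y i j) x v.
  exact/diff_derivable/(differentiable_comp dg (differentiable_coord _ i j)).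
have E i j : (fun y => (f y *m g y) i j) =
    \sum_l ((fun y => f y i l) * (fun y => g y l j)).
  by apply/funext => y; rewrite fct_sumE mxE.
rewrite derive_mx; last first.
  apply/derivable_mxP => i j; rewrite E.
  by apply: derivable_sum => l; exact: derivableM.
apply/matrixP => i j; rewrite !mxE E derive_sum; last first.
  by move=> l; exact: derivableM.
rewrite -big_split /=; apply: eq_bigr => l _.
rewrite deriveM // (derive_coord v i l df) (derive_coord v l j dg).
by rewrite /GRing.scale /= [LHS]addrC [X in X + _ = _]mulrC.
Qed.

Lemma derive_trmx (U : normedModType R) m n (f : U -> 'M[R]_(m, n)) x v :
  differentiable f x -> 'D_v (fun y => (f y)^T) x = ('D_v f x)^T.
Proof.
move=> df.
have df' i j : derivable (fun y => f y i j) x v.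
  exact/diff_derivable/(differentiable_comp df (differentiable_coord _ i j)).
rewrite derive_mx; last first.
  apply/derivable_mxP => i j.
  by have -> : (fun y => (f y)^T i j) = (fun y => f y j i)
    by apply/funext => y; rewrite mxE.
apply/matrixP => i j; rewrite !mxE (derive_coord v j i df).
have -> : (fun y => (f y)^T i j) = (fun y => f y j i) by apply/funext => y; rewrite mxE.
by [].
Qed.

End Composition.

(** * Symmetry of second derivatives *)

Section Schwarz.
Variables (R : realType) (U : normedModType R).
Implicit Types (V : set U) (f : U -> R).

Lemma is_derive_line f y v (s : R) : differentiable f (y + s *: v) ->
  is_derive s 1 (fun s => f (y + s *: v)) ('D_v f (y + s *: v)).
Proof.
move=> df; pose l : R -> U := cst y + ( *:%R^~ v : R -> U).
have dl : is_diff s l (0 + ( *:%R^~ v : R -> U)) by exact: is_diffD.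
have dfl : differentiable (f \o l) s.
  by apply: differentiable_comp; [exact: ex_diff|exact: df].
split; first exact: diff_derivable.
rewrite deriveE // (@diff_comp _ _ _ _ l f) //=.
by rewrite diff_val deriveE // fctE /= add0r scale1r.
Qed.

Lemma line_MVT f y v (h : R) : 0 < h ->
  (forall s, 0 <= s <= h -> differentiable f (y + s *: v)) ->
  exists2 s, 0 <= s <= h & f (y + h *: v) - f y = 'D_v f (y + s *: v) * h.
Proof.
move=> h0 df.
have [s||s sh] := @MVT R (fun s => f (y + s *: v))
    (fun s => 'D_v f (y + s *: v)) 0 h h0.
- rewrite in_itv /= => /andP[s0 sh].
  by apply: is_derive_line; apply: df; rewrite !ltW.
- apply: continuous_in_subspaceT => s; rewrite inE /= in_itv /= => sh.
  by have [/derivable1_diffP/differentiable_continuous] := is_derive_line (df _ sh).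
- rewrite subr0 scale0r addr0 => ->; exists s => //.
  by move: sh; rewrite in_itv /= => /andP[/ltW-> /ltW->].
Qed.

(* Two applications of the mean value theorem; exchanging [v] and [w] leaves the
   left-hand side unchanged, whence Schwarz's theorem. *)
Lemma second_difference f V x v w (h : R) : 0 < h -> Ck_on 2 V f ->
  (forall s t, 0 <= s <= h -> 0 <= t <= h -> V (x + s *: v + t *: w)) ->
  exists st : R * R, [/\ 0 <= st.1 <= h, 0 <= st.2 <= h
  & f (x + h *: v + h *: w) - f (x + h *: v) - (f (x + h *: w) - f x) =
    'D_w ('D_v f) (x + st.1 *: v + st.2 *: w) * h * h].
Proof.
move=> h0 [df Df] Vx.
have hh : 0 <= h <= h by rewrite ltW /=.
have h00 : (0:R) <= 0 <= h by rewrite lexx ltW.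
have V0 s : 0 <= s <= h -> V (x + s *: v).
  by move=> sh; have := Vx _ _ sh h00; rewrite scale0r addr0.
have Vh s : 0 <= s <= h -> V (x + h *: w + s *: v).
  by move=> sh; have := Vx _ _ sh hh; rewrite addrAC.
pose g y := f (y + h *: w) - f y.
have dsh s : 0 <= s <= h -> is_derive (x + s *: v) v (fun y => f (y + h *: w))
    ('D_v f (x + s *: v + h *: w)) /\ differentiable g (x + s *: v).
  move=> sh.
  have da : is_diff (x + s *: v) (id + cst (h *: w)) (id + 0) by exact: is_diffD.
  have dfa : differentiable f ((id + cst (h *: w)) (x + s *: v)).
    by apply: df; exact: Vx.
  have dc : differentiable (f \o (id + cst (h *: w))) (x + s *: v).
    by apply: differentiable_comp; [exact: ex_diff|exact: dfa].
  split; last by apply: differentiableB => //; exact/df/V0.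
  split; first exact: diff_derivable.
  rewrite deriveE // (@diff_comp _ _ _ _ (id + cst (h *: w)) f) //=.
  by rewrite diff_val deriveE // addr0.
have [s sh Es] := line_MVT h0 (fun s sh => (dsh s sh).2).
have [df1 df2] := dsh s sh; have dfs : differentiable f (x + s *: v) by exact/df/V0.
have Dg : 'D_v g (x + s *: v) =
    'D_v f (x + s *: v + h *: w) - 'D_v f (x + s *: v).
  have -> : g = (fun y => f (y + h *: w)) - f by [].
  by rewrite deriveB ?derive_val //; apply: diff_derivable.
have [|t th Et] := @line_MVT ('D_v f) (x + s *: v) w h h0.
  by move=> t th; have [/(_ _ (Vx _ _ sh th))] := Df v.
exists (s, t); split => //=.
by rewrite -Et -Dg -Es /g addrAC.
Qed.

Lemma second_difference_sym (a b c d : R) : a - b - (c - d) = a - c - (b - d).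
Proof. by rewrite !opprB !addrA (addrAC _ d) [in RHS]addrAC -!addrA (addrCA (- b)). Qed.

Lemma dist_le_split (a b c e : R) : `|a - c| < e / 2 -> `|b - c| < e / 2 ->
  `|a - b| <= e.
Proof.
move=> ac bc; have -> : a - b = (a - c) - (b - c) by rewrite opprB addrA subrK.
by rewrite (splitr e) (le_trans (ler_normB _ _)) // lerD // ltW.
Qed.

(** The second difference over a small parallelogram of side h is h^2 times either mixed derivative,
    each at some point of the parallelogram. Both are continuous at [x], so their values there
    differ by at most any e > 0. *)
Lemma derive_swap_scalar f V x v w : open V -> V x -> Ck_on 2 V f ->
  'D_v ('D_w f) x = 'D_w ('D_v f) x.
Proof.
move=> oV Vx cf; apply/eqP; rewrite -subr_eq0 -normr_le0.
apply/ler_addgt0Pr => e e0; rewrite add0r.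
have c1 : {for x, continuous ('D_v ('D_w f))}.
  by have [_ /(_ w)[_ /(_ v)]] := cf; apply.
have c2 : {for x, continuous ('D_w ('D_v f))}.
  by have [_ /(_ v)[_ /(_ w)]] := cf; apply.
have e20 : 0 < e / 2 by rewrite divr_gt0.
have : \forall y \near x, [/\ V y, `|'D_v ('D_w f) x - 'D_v ('D_w f) y| < e / 2
    & `|'D_w ('D_v f) x - 'D_w ('D_v f) y| < e / 2].
  have n0 : nbhs x V by exact: open_nbhs_nbhs.
  have n1 : \forall y \near x, `|'D_v ('D_w f) x - 'D_v ('D_w f) y| < e / 2.
    exact: (@cvgrPdist_lt _ R _ _ _ _ _).1 c1 _ e20.
  have n2 : \forall y \near x, `|'D_w ('D_v f) x - 'D_w ('D_v f) y| < e / 2.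
    exact: (@cvgrPdist_lt _ R _ _ _ _ _).1 c2 _ e20.
  by apply: filterS3 n0 n1 n2 => y.
move=> /nbhs_ballP[d /= d0 Bd].
(* This keeps the parallelogram inside the ball of radius [d]; the summand 1 prevents a zero
   denominator when [v] and [w] vanish. *)
pose h := d / (2 * (`|v| + `|w| + 1)).
have N0 : 0 < 2 * (`|v| + `|w| + 1).
  by rewrite mulr_gt0 // ltr_wpDl // addr_ge0.
have h0 : 0 < h by rewrite divr_gt0.
have Bh s t : 0 <= s <= h -> 0 <= t <= h -> ball x d (x + s *: v + t *: w).
  move=> /andP[s0 sh] /andP[t0 th].
  rewrite -ball_normE /= -addrA opprD addNKr normrN.
  have : `|s *: v + t *: w| <= h * (`|v| + `|w| + 1).
    apply: le_trans (ler_normD _ _) _; rewrite !normrZ !ger0_norm //.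
    rewrite !mulrDr mulr1 -[leLHS]addr0; apply: lerD; last exact: ltW.
    by apply: lerD; apply: ler_wpM2r.
  move=> /le_lt_trans; apply.
  have -> : h * (`|v| + `|w| + 1) = d / 2.
    have : `|v| + `|w| + 1 != 0 by rewrite gt_eqF // ltr_wpDl // addr_ge0.
    by rewrite /h; move: (_ + 1) => N N1; field.
  by rewrite ltr_pdivrMr // ltr_pMr // ltr1n.
have [|[s t] /= [s1 t1 E1]] := @second_difference f V x v w h h0 cf.
  by move=> s t sh th; have [] := Bd _ (Bh _ _ sh th).
have [|[s' t'] /= [s2 t2 E2]] := @second_difference f V x w v h h0 cf.
  move=> s' t' sh th; have [] := Bd _ (Bh _ _ th sh).
  by rewrite addrAC.
have E : 'D_w ('D_v f) (x + s *: v + t *: w) = 'D_v ('D_w f) (x + s' *: w + t' *: v).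
  apply: (mulIf (lt0r_neq0 h0)); apply: (mulIf (lt0r_neq0 h0)).
  apply: etrans (esym E1) (etrans _ E2).
  by rewrite (addrAC x (h *: w)); exact: second_difference_sym.
have [_ _ B1] := Bd _ (Bh _ _ s1 t1).
have [_ + _] := Bd _ (Bh _ _ t2 s2); rewrite addrAC -E => B2.
exact: (dist_le_split B2 B1).
Qed.

Lemma derive_swap m n (f : U -> 'M[R]_(m, n)) V x v w : open V -> V x ->
  Ck_on 2 V f -> 'D_v ('D_w f) x = 'D_w ('D_v f) x.
Proof.
move=> oV Vx cf; apply/matrixP => i j.
have E a b : 'D_a ('D_b f) x i j = 'D_a ('D_b (fun y => f y i j)) x.
  have [df /(_ b) [Df _]] := cf.
  rewrite derive_coord; last exact: Df.
  apply: near_eq_derive; near=> y; apply: derive_coord; apply: df.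
  by near: y; exact: open_nbhs_nbhs.
have H := derive_swap_scalar v w oV Vx (Ck_on_coord i j oV cf).
exact: etrans (etrans (E v w) H) (esym (E w v)).
Unshelve. all: by end_near. Qed.

End Schwarz.

(** * The equation for the complement at a point *)

Section LeviTrace.
Variables (R : realType) (n m : nat).
Implicit Types (H : 'M[R]_n) (T : 'I_m -> 'M[R]_n) (V : 'M[R]_(m, n)).

(* Throughout, [H] is the contravariant metric at a point, [th] a coframe whose
   [m] columns span the annihilator of D, and [T c] the matrix of the exterior
   derivative of the [c]-th column; [- T c] restricted to D is the component
   L^c of the Levi form, so [cometric H T] is h^ab. *)
Definition cometric H T : 'M[R]_m :=
  \matrix_(a, b) (- 2^-1 * \tr (T a *m H *m T b *m H)).

(** Up to sign, the Levi form with its Q-index lowered and both D-indices raised. *)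
Definition raised_levi H T c : 'M[R]_n :=
  \sum_a invmx (cometric H T) a c *: (H *m T a *m H).

(** The interior products of [X] with the forms d theta^c, one in each row. *)
Definition contraction T (X : 'rV[R]_n) : 'M[R]_(m, n) := \matrix_c (X *m T c).

Definition symmetrized (A : 'M[R]_m) : 'M[R]_m := A + A^T.

Definition levi_trace H T (N : 'rV[R]_n -> 'M[R]_m) (Z : 'rV[R]_n) : 'rV[R]_m :=
  \row_d \sum_c N (Z *m raised_levi H T c) c d.

(* A complement of D with basis u_a dual to [th] is encoded by [V], whose rows
   are h^ab u_b.  With [DK X] the derivative of h^ab along [X], the argument of
   [levi_trace] is the derivative of the cometric of Q for the partial connection
   X, u |-> q([X, u]).  Up to a factor and the raising of indices, changing the
   complement by f changes the equation by the bundle map applied to f. *)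
Definition splitting_eq H T (DK : 'rV[R]_n -> 'M[R]_m) V : Prop :=
  forall Z, levi_trace H T (fun X => DK X - symmetrized (contraction T X *m V^T)) Z = 0.

(** For a coframe [th], the condition [V *m th = 0] puts the rows of [V] in D: such a [V] is the
    difference of two complements with the same normalisation. This is the hypothesis on the bundle
    map, transcribed to coframes. *)
Definition injective_at H T (th : 'M[R]_(n, m)) : Prop :=
  forall V, V *m th = 0 ->
  (forall Z, levi_trace H T (fun X => symmetrized (contraction T X *m V^T)) Z = 0) ->
  V = 0.

Lemma cometric_sym H T : (cometric H T)^T = cometric H T.
Proof.
apply/matrixP => a b; rewrite !mxE; congr (_ * _).
by rewrite -mulmxA mxtrace_mulC mulmxA.
Qed.

Lemma levi_traceB H T N N' Z :
  levi_trace H T (fun X => N X - N' X) Z = levi_trace H T N Z - levi_trace H T N' Z.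
Proof.
apply/rowP => d; rewrite !mxE -sumrB; apply: eq_bigr => c _.
by rewrite !mxE.
Qed.

Lemma eq_levi_trace H T N N' Z : (forall c, N (Z *m raised_levi H T c) =
  N' (Z *m raised_levi H T c)) -> levi_trace H T N Z = levi_trace H T N' Z.
Proof. by move=> NN; apply/rowP => d; rewrite !mxE; apply: eq_bigr => c _; rewrite NN. Qed.

Lemma contraction_is_linear T : linear (contraction T).
Proof.
move=> a X Y; apply/row_matrixP => c.
by rewrite linearP /= !rowK mulmxDl scalemxAl.
Qed.

Lemma symmetrized_is_linear : linear symmetrized.
Proof.
by move=> a A B; rewrite /symmetrized linearP /= scalerDr addrACA.
Qed.

HB.instance Definition _ :=
  GRing.isLinear.Build R _ _ _ symmetrized symmetrized_is_linear.

HB.instance Definition _ T :=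
  GRing.isLinear.Build R _ _ _ (contraction T) (contraction_is_linear T).

Lemma splitting_eq_unique H T th DK V V' : injective_at H T th ->
  V *m th = V' *m th -> splitting_eq H T DK V -> splitting_eq H T DK V' -> V = V'.
Proof.
move=> inj Vth eV eV'; apply/eqP; rewrite -subr_eq0; apply/eqP; apply: inj.
  by rewrite mulmxBl Vth subrr.
move=> Z; have := congr2 (fun a b => b - a) (eV Z) (eV' Z).
rewrite subrr -levi_traceB => <-; apply: eq_levi_trace => c.
rewrite opprB [RHS]addrC subrKA linearB /= mulmxBr.
by rewrite linearB.
Qed.

Lemma raised_levi_left H T c (th : 'M[R]_(n, m)) : H^T = H -> H *m th = 0 ->
  th^T *m raised_levi H T c = 0.
Proof.
move=> Hs Hth; rewrite /raised_levi mulmx_sumr big1 // => a _.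
by rewrite -scalemxAr !mulmxA -[H in th^T *m H]Hs -trmx_mul Hth trmx0 !mul0mx scaler0.
Qed.

Lemma raised_levi_right H T c (th : 'M[R]_(n, m)) : H *m th = 0 ->
  raised_levi H T c *m th = 0.
Proof.
move=> Hth; rewrite /raised_levi mulmx_suml big1 // => a _.
by rewrite -scalemxAl -!mulmxA Hth !mulmx0 scaler0.
Qed.

Lemma levi_trace_linear H T (N : {linear 'rV[R]_n -> 'M[R]_m}) :
  linear (levi_trace H T N).
Proof.
move=> a X Y; apply/rowP => d; rewrite !mxE mulr_sumr -big_split /=.
apply: eq_bigr => c _.
by rewrite mulmxDl -scalemxAl linearP /= !mxE.
Qed.

Definition levi_trace_mx H T (N : 'rV[R]_n -> 'M[R]_m) : 'M[R]_(n, m) :=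
  \matrix_p levi_trace H T N (delta_mx 0 p).

Lemma mul_levi_trace_mx H T (N : {linear 'rV[R]_n -> 'M[R]_m}) Z :
  Z *m levi_trace_mx H T N = levi_trace H T N Z.
Proof.
pose L : {linear 'rV[R]_n -> 'rV[R]_m} := HB.pack (levi_trace H T N)
  (GRing.isLinear.Build _ _ _ _ _ (levi_trace_linear H T N)).
rewrite -[RHS]/(L Z) [in RHS](row_sum_delta Z) linear_sum mulmx_sum_row.
by apply: eq_bigr => i _; rewrite linearZ rowK.
Qed.

(** The raised Levi form is a bivector of D, hence annihilated by [th]. The equation therefore
    carries no information in the directions of [th], and this leaves room for the gauge term. *)
Lemma levi_trace_mx_coframe H T (N : {linear 'rV[R]_n -> 'M[R]_m}) (th : 'M[R]_(n, m)) :
  H^T = H -> H *m th = 0 -> th^T *m levi_trace_mx H T N = 0.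
Proof.
move=> Hs Hth; apply/row_matrixP => i; rewrite row_mul mul_levi_trace_mx row0.
apply/rowP => d; rewrite !mxE big1 // => c _.
by rewrite -row_mul raised_levi_left // row0 linear0 mxE.
Qed.

Definition symbol T V (X : 'rV[R]_n) := symmetrized (contraction T X *m V^T).

Lemma symbol_linear T V : linear (symbol T V).
Proof.
move=> a X Y; rewrite /symbol contraction_is_linear mulmxDl -scalemxAl.
exact: symmetrized_is_linear.
Qed.

HB.instance Definition _ T V :=
  GRing.isLinear.Build _ _ _ _ (symbol T V) (symbol_linear T V).

(* The gauge term [V th th^T] and the equation term take values in complementary
   subspaces, so this square system encodes both [V th = K] and [splitting_eq]. *)
Definition splitting_op H T (th : 'M[R]_(n, m)) V : 'M[R]_(m, n) :=
  V *m (th *m th^T) + (levi_trace_mx H T (symbol T V))^T.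

Lemma splitting_op_linear H T th : linear (splitting_op H T th).
Proof.
move=> a V V'; rewrite /splitting_op mulmxDl -scalemxAl scalerDr addrACA.
congr (_ + _); rewrite -linearP; congr (_^T); apply/row_matrixP => p.
rewrite linearP /= !rowK; apply/rowP => d; rewrite !mxE mulr_sumr -big_split /=.
apply: eq_bigr => c _; rewrite /symbol linearP /= mulmxDr -scalemxAr.
by rewrite symmetrized_is_linear !mxE.
Qed.

HB.instance Definition _ H T th :=
  GRing.isLinear.Build _ _ _ _ (splitting_op H T th) (splitting_op_linear H T th).

(** * Solving the equation by an invertible square system *)

Section Solve.
Variables (H : 'M[R]_n) (T : 'I_m -> 'M[R]_n) (th : 'M[R]_(n, m)).
Hypotheses (Hs : H^T = H) (Hth : H *m th = 0) (th1 : th^T *m th \in unitmx).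

Lemma splitting_op_inj : injective_at H T th -> injective (splitting_op H T th).
Proof.
move=> inj; apply: raddf_inj => V; rewrite -[LHS]/(splitting_op H T th V) => VE.
have Vth : V *m th = 0.
  (* Right multiplication by [th] kills the equation term, so the gauge term vanishes separately. *)
  have := congr1 (mulmx^~ th) VE; rewrite mulmxDl mul0mx.
  rewrite -[X in _ + _ *m X]trmxK -trmx_mul levi_trace_mx_coframe // trmx0 addr0.
  rewrite mulmxA -mulmxA => /(congr1 (mulmx^~ (invmx (th^T *m th)))); rewrite mulmxK // mul0mx.
 by [].
move: VE; rewrite /splitting_op mulmxA Vth mul0mx add0r => /(congr1 trmx).
rewrite trmxK trmx0 => VE; apply: inj => // Z.
by rewrite -[LHS](mul_levi_trace_mx H T (symbol T V)) VE mulmx0.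
Qed.

Lemma lin_splitting_op_unit : injective_at H T th ->
  lin_mx (splitting_op H T th) \in unitmx.
Proof.
move=> inj; rewrite -row_free_unit -kermx_eq0; apply/eqP/row_matrixP => i.
rewrite row0; set u := row i _.
have : u *m lin_mx (splitting_op H T th) = 0.
  by rewrite -row_mul mulmx_ker row0.
rewrite -[u]vec_mxK mul_vec_lin -(linear0 (@mxvec R m n)).
move=> /(can_inj mxvecK) /eqP; rewrite -(linear0 (splitting_op H T th)).
by move=> /eqP/(splitting_op_inj inj) ->; rewrite linear0.
Qed.

Variable DK : {linear 'rV[R]_n -> 'M[R]_m}.

Definition splitting_rhs : 'M[R]_(m, n) :=
  cometric H T *m th^T + (levi_trace_mx H T DK)^T.

Definition splitting_sol : 'M[R]_(m, n) :=
  vec_mx (mxvec splitting_rhs *m invmx (lin_mx (splitting_op H T th))).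

Lemma splitting_solP : injective_at H T th ->
  splitting_sol *m th = cometric H T /\ splitting_eq H T DK splitting_sol.
Proof.
move=> inj; have E : splitting_op H T th splitting_sol = splitting_rhs.
  apply: (can_inj mxvecK).
  by rewrite -mul_vec_lin vec_mxK mulmxKV // lin_splitting_op_unit.
have gauge : splitting_sol *m th = cometric H T.
  have := congr1 (mulmx^~ th) E; rewrite !mulmxDl.
  rewrite -[X in _ + _ *m X = _]trmxK -[X in _ = _ + _ *m X]trmxK -!trmx_mul.
  rewrite !levi_trace_mx_coframe // !trmx0 !addr0 mulmxA -!mulmxA [in LHS]mulmxA.
  by move=> /(congr1 (mulmx^~ (invmx (th^T *m th)))); rewrite !mulmxK.
split=> // Z; rewrite levi_traceB.
move: E; rewrite /splitting_op /splitting_rhs mulmxA gauge => /addrI/trmx_inj E.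
rewrite -[X in X - _](mul_levi_trace_mx H T DK).
by rewrite -[X in _ - X](mul_levi_trace_mx H T (symbol T splitting_sol)) E subrr.
Qed.

End Solve.

(** * Behaviour of the equation under a change of coframe *)

Section FrameChange.
Variables (H : 'M[R]_n) (T T' : 'I_m -> 'M[R]_n) (th : 'M[R]_(n, m)).
Variables (A : 'M[R]_m) (B : 'rV[R]_n -> 'M[R]_m).
Hypotheses (Hs : H^T = H) (Hth : H *m th = 0) (uA : A \in unitmx).
(** This is the interior product of X with d(theta A), where [B X] stands for the derivative of A
    along X. The other half of dA /\ theta is absent because theta(X) = 0. *)
Hypothesis TA : forall X, X *m th = 0 ->
  contraction T' X = A^T *m contraction T X + (B X)^T *m th^T.

(** The derivative of A enters only through a multiple of [th^T], which [H] annihilates: on D the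
    forms d theta^a transform as tensors. *)
Lemma sandwich_change a : H *m T' a *m H = \sum_b A b a *: (H *m T b *m H).
Proof.
apply/row_matrixP => i; rewrite -mulmxA !row_mul.
have /TA/(congr1 (row a)) : row i H *m th = 0 by rewrite -row_mul Hth row0.
rewrite linearD /= !row_mul !rowK mulmxA => ->.
rewrite mulmxDl -!mulmxA -[H in th^T *m H]Hs -trmx_mul Hth trmx0 !mulmx0 addr0.
rewrite mulmxA [X in X *m H]mulmx_sum_row linear_sum /= mulmx_suml; apply: eq_bigr => b _.
by rewrite rowK !mxE linearZ /= -scalemxAl -!mulmxA !row_mul.
Qed.

Lemma cometric_change : cometric H T' = A^T *m cometric H T *m A.
Proof.
apply/matrixP => a b; rewrite !mxE.
have -> : \tr (T' a *m H *m T' b *m H) =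
    \sum_d \sum_c A c a * A d b * \tr (T c *m H *m T d *m H).
  have trC (P Q : 'M[R]_n) : \tr (P *m H *m Q *m H) = \tr (Q *m (H *m P *m H)).
    by rewrite -[in LHS]mulmxA mxtrace_mulC !mulmxA.
  have mA (P Q : 'M[R]_n) : P *m H *m Q *m H = P *m (H *m Q *m H).
    by rewrite !mulmxA.
  rewrite trC sandwich_change mulmx_sumr raddf_sum [RHS]exchange_big /=.
  apply: eq_bigr => c _; rewrite -scalemxAr mxtraceZ -trC mA sandwich_change.
  rewrite mulmx_sumr raddf_sum mulr_sumr /=; apply: eq_bigr => d _.
  by rewrite -scalemxAr mxtraceZ -mA mulrA.
rewrite mulr_sumr; apply: eq_bigr => d _.
rewrite !mxE mulr_sumr mulr_suml; apply: eq_bigr => c _.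
by rewrite !mxE; ring.
Qed.

Hypothesis uK : cometric H T \in unitmx.

Lemma cometric_change_unit : cometric H T' \in unitmx.
Proof. by rewrite cometric_change !unitmx_mul unitmx_tr uA uK. Qed.

Lemma raised_levi_change c :
  raised_levi H T' c = \sum_r invmx A c r *: raised_levi H T r.
Proof.
have AK : A *m invmx (cometric H T') = invmx (cometric H T) *m (invmx A)^T.
  rewrite trmx_inv; apply: (can_inj (mulmxK cometric_change_unit)).
  by rewrite mulmxKV ?cometric_change_unit // cometric_change !mulmxA mulmxKV
    ?unitmx_tr // mulVmx // mul1mx.
transitivity (\sum_b (A *m invmx (cometric H T')) b c *: (H *m T b *m H)).
  rewrite /raised_levi.
  under eq_bigr => a _ do rewrite sandwich_change scaler_sumr.
  rewrite exchange_big /=; apply: eq_bigr => b _.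
  rewrite mxE scaler_suml; apply: eq_bigr => a _.
  by rewrite scalerA mulrC.
rewrite AK /raised_levi.
under [RHS]eq_bigr => r _ do rewrite scaler_sumr.
rewrite [RHS]exchange_big /=; apply: eq_bigr => b _.
rewrite mxE scaler_suml; apply: eq_bigr => r _.
by rewrite scalerA mxE mulrC.
Qed.

(** The cancellation that makes the construction independent of the coframe. Since [K] is symmetric,
    the two Leibniz terms in [b] are transposes of each other, and the symmetrization of the
    inhomogeneous term of the contraction is exactly their sum. *)
Lemma symmetrized_change (D P K b : 'M[R]_m) : K^T = K ->
  b^T *m K *m A + A^T *m D *m A + A^T *m K *m b -
    symmetrized (A^T *m P *m A + b^T *m K *m A) =
  A^T *m (D - symmetrized P) *m A.
Proof.
move=> Ks; rewrite /symmetrized [(_ + _)^T]linearD /= !trmx_mul !trmxK Ks !mulmxA.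
rewrite mulmxBr mulmxBl mulmxDr mulmxDl.
move: (b^T *m K *m A) (A^T *m D *m A) (A^T *m K *m b) (A^T *m P *m A)
  (A^T *m P^T *m A) => x y z p q.
by apply/matrixP => i j; rewrite !mxE; ring.
Qed.

Lemma splitting_eq_change (DK DK' : {linear 'rV[R]_n -> 'M[R]_m}) V :
  V *m th = cometric H T ->
  (forall X, X *m th = 0 -> DK' X = (B X)^T *m cometric H T *m A +
     A^T *m DK X *m A + A^T *m cometric H T *m B X) ->
  splitting_eq H T DK V -> splitting_eq H T' DK' (A^T *m V).
Proof.
move=> Vth DK'E eV Z.
pose N : {linear 'rV[R]_n -> 'M[R]_m} := DK \- symbol T V.
pose N' X := DK' X - symmetrized (contraction T' X *m (A^T *m V)^T).
have NE X : X *m th = 0 -> N' X = A^T *m N X *m A.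
  move=> Xth; rewrite /N' DK'E // TA // trmx_mul trmxK.
  rewrite -(symmetrized_change _ _ (B X) (cometric_sym H T)); congr (_ - symmetrized _).
  rewrite mulmxDl !mulmxA; congr (_ + _); congr (_ *m _).
  by rewrite -mulmxA -trmx_mul Vth cometric_sym.
have sN q : \sum_r N (Z *m raised_levi H T r) r q = 0.
  by have /rowP/(_ q) := eV Z; rewrite !mxE.
apply/rowP => d; rewrite !mxE.
(* The trace pairs an index on which A acts with the lowered index of [raised_levi], on which the
   inverse of A acts. They cancel, leaving the old equation multiplied by A in its free index. *)
transitivity (\sum_c \sum_r invmx A c r *
    (A^T *m (N (Z *m raised_levi H T r) *m A)) c d).
  apply: eq_bigr => c _; rewrite -[LHS]/(N' _ c d) NE; last first.
    by rewrite -mulmxA raised_levi_right // mulmx0.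
  rewrite raised_levi_change mulmx_sumr linear_sum mulmx_sumr mulmx_suml summxE.
  apply: eq_bigr => r _.
  by rewrite -scalemxAr linearZ /= -scalemxAr -scalemxAl mxE mulmxA.
transitivity (\sum_r ((invmx A)^T *m A^T *m (N (Z *m raised_levi H T r) *m A)) r d).
  rewrite exchange_big; apply: eq_bigr => r _ /=; rewrite -mulmxA [RHS]mxE.
  by apply: eq_bigr => c _; rewrite [in RHS]mxE.
under eq_bigr => r _ do rewrite -trmx_mul mulmxV // trmx1 mul1mx mxE.
rewrite exchange_big big1 //= => q _.
by rewrite -mulr_suml sN mul0r.
Qed.

End FrameChange.
End LeviTrace.

(** * Coframes and uniqueness of the metric *)

Section Coframes.
Variables (R : realType) (n : nat).
Implicit Types (H : 'rV[R]_n -> 'M[R]_n) (V W : set 'rV[R]_n).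

Definition dform m (th : 'rV[R]_n -> 'M[R]_(n, m)) x (c : 'I_m) : 'M[R]_n :=
  \matrix_(p, q) ('D_(delta_mx 0 p) th x q c - 'D_(delta_mx 0 q) th x p c).

Definition coframe_on H V m (th : 'rV[R]_n -> 'M[R]_(n, m)) : Prop :=
  smooth_on V th /\
  forall y, V y -> [/\ H y *m th y = 0, (\rank (H y) + m = n)%N & \rank (th y) = m].

Definition cometric_field H m (th : 'rV[R]_n -> 'M[R]_(n, m)) y : 'M[R]_m :=
  cometric (H y) (dform th y).

(* The differential of the cometric, written so as to be linear by construction. *)
Definition cometric_diff H m (th : 'rV[R]_n -> 'M[R]_(n, m)) x (X : 'rV[R]_n) : 'M[R]_m :=
  \sum_q X 0 q *: 'D_(delta_mx 0 q) (cometric_field H th) x.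

Lemma cometric_diff_linear H m (th : 'rV[R]_n -> 'M[R]_(n, m)) x :
  linear (cometric_diff H th x).
Proof.
move=> a X Y; rewrite /cometric_diff scaler_sumr -big_split /=.
by apply: eq_bigr => q _; rewrite !mxE scalerDl scalerA.
Qed.

HB.instance Definition _ H m (th : 'rV[R]_n -> 'M[R]_(n, m)) x :=
  GRing.isLinear.Build _ _ _ _ (cometric_diff H th x) (cometric_diff_linear H th x).

Lemma cometric_diffE H m (th : 'rV[R]_n -> 'M[R]_(n, m)) x X :
  differentiable (cometric_field H th) x ->
  cometric_diff H th x X = 'D_X (cometric_field H th) x.
Proof. by move=> dK; exact/esym/derive_sum_coord. Qed.

(* [G] is the inverse of the contravariant metric h + h^ab u_a u_b. *)
Definition canonical_at H x (G : 'M[R]_n) : Prop :=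
  exists m (th : 'rV[R]_n -> 'M[R]_(n, m)) V (v : 'M[R]_(m, n)),
  [/\ open_nbhs x V, coframe_on H V th, v *m th x = cometric_field H th x,
      splitting_eq (H x) (dform th x) (cometric_diff H th x) v
    & G *m (H x + v^T *m invmx (cometric_field H th x) *m v) = 1%:M].

Definition posdef_mx k (A : 'M[R]_k) : Prop :=
  forall u : 'rV[R]_k, u != 0 -> 0 < (u *m A *m u^T) 0 0.

(** The coframe form of the two hypotheses of the theorem: surjectivity of the Levi form appears as
    positivity of h^ab. *)
Definition regular_at H x : Prop :=
  forall m (th : 'rV[R]_n -> 'M[R]_(n, m)) V, open_nbhs x V -> coframe_on H V th ->
  posdef_mx (cometric_field H th x) /\ injective_at (H x) (dform th x) (th x).

Lemma posdef_unitmx k (A : 'M[R]_k) : posdef_mx A -> A \in unitmx.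
Proof.
move=> pA; rewrite -row_free_unit -kermx_eq0; apply/eqP/row_matrixP => i.
rewrite row0; apply/eqP/negPn/negP => /pA.
by rewrite -row_mul mulmx_ker row0 mul0mx mxE ltxx.
Qed.

Lemma mul_tr_gt0 k (z : 'rV[R]_k) : z != 0 -> 0 < (z *m z^T) 0 0.
Proof.
move=> z0; have sq : (z *m z^T) 0 0 = \sum_i z 0 i ^+ 2.
  by rewrite mxE; apply: eq_bigr => i _; rewrite mxE.
rewrite sq lt_neqAle sumr_ge0 ?andbT; last by move=> i _; exact: sqr_ge0.
apply: contra z0; rewrite eq_sym psumr_eq0; last by move=> i _; exact: sqr_ge0.
move=> /allP z0; apply/eqP/rowP => i; rewrite [RHS]mxE.
by have := z0 i (mem_index_enum i); rewrite /= sqrf_eq0 => /eqP.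
Qed.

Lemma near_unitmx k V (f : 'rV[R]_n -> 'M[R]_k) x : open_nbhs x V ->
  smooth_on V f -> f x \in unitmx ->
  exists W, [/\ open_nbhs x W, W `<=` V & forall y, W y -> f y \in unitmx].
Proof.
move=> [oV Vx] cf ux.
have cd : {for x, continuous (fun y => \det (f y))}.
  exact: (Ck_on_det oV (cf 0%N)).
have : \forall y \near x, \det (f y) != 0.
  have d0 : \det (f x) != 0 by rewrite -unitfE -unitmxE.
  have dn : nbhs (\det (f x)) [set z | z != 0].
    by apply: open_nbhs_nbhs; split => //; exact: open_neq.
  exact: cd dn.
have nV : nbhs x V by exact: open_nbhs_nbhs.
move=> /(filterI nV); rewrite nbhsE => -[W oW WV].
exists W; split=> // [y /WV[]//|y /WV[_]]; by rewrite unitmxE unitfE.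
Qed.

Lemma smooth_onS (U1 W1 : normedModType R) (A B : set U1) (f : U1 -> W1) :
  B `<=` A -> smooth_on A f -> smooth_on B f.
Proof. by move=> BA sf k; exact: Ck_on_subset (sf k). Qed.

Lemma coframe_onS H V W m (th : 'rV[R]_n -> 'M[R]_(n, m)) : W `<=` V ->
  coframe_on H V th -> coframe_on H W th.
Proof.
by move=> WV [sth Vth]; split=> [|y /WV/Vth//]; exact: smooth_onS sth.
Qed.

Lemma smooth_differentiable (U1 W1 : normedModType R) (A : set U1) (f : U1 -> W1) y :
  smooth_on A f -> A y -> differentiable f y.
Proof. by move=> /(_ 1%N) [df _] Ay; apply: df. Qed.

Lemma dform_smooth V m (th : 'rV[R]_n -> 'M[R]_(n, m)) c : open V ->
  smooth_on V th -> smooth_on V (fun y => dform th y c).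
Proof.
move=> oV sth k; apply: Ck_on_mx => // i j.
have D p q : Ck_on k V (fun y => 'D_(delta_mx 0 p) th y q c).
  by apply: Ck_on_coord => //; exact: (Ck_on_derive _ (sth k.+1)).
have := Ck_onD oV (D i j) (Ck_onN oV (D j i)).
by apply: Ck_on_eq => // y _; rewrite mxE.
Qed.

Lemma cometric_smooth H V m (th : 'rV[R]_n -> 'M[R]_(n, m)) : open V ->
  smooth_on V H -> smooth_on V th -> smooth_on V (cometric_field H th).
Proof.
move=> oV sH sth k; apply: Ck_on_mx => // a b.
have : Ck_on k V (fun y => - 2^-1 *
    \tr (dform th y a *m H y *m dform th y b *m H y)).
  apply: Ck_onM => //; first exact: Ck_on_cst.
  have sD c : Ck_on k V (fun y => dform th y c) by exact: (dform_smooth _ oV sth).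
  apply: Ck_on_mxtrace => //; apply: Ck_on_mulmx (sH k) => //.
  apply: Ck_on_mulmx (sD b) => //.
  by apply: Ck_on_mulmx (sH k).
by apply: Ck_on_eq => // y _; rewrite mxE.
Qed.

Lemma contraction_dform m (th : 'rV[R]_n -> 'M[R]_(n, m)) x X :
  differentiable th x ->
  contraction (dform th x) X =
    ('D_X th x)^T - \matrix_(c, q) (X *m 'D_(delta_mx 0 q) th x) 0 c.
Proof.
move=> dth; apply/matrixP => c q; rewrite [LHS]mxE [LHS]mxE [RHS]mxE.
rewrite [X in _ = X + _]mxE (derive_sum_coord X dth) summxE.
rewrite [X in _ = _ + X]mxE [in X in _ = _ + X]mxE [X in _ = _ - X]mxE -sumrB.
by apply: eq_bigr => p _; rewrite !mxE mulrBr.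
Qed.

Lemma coframe_kermx H V m (th : 'rV[R]_n -> 'M[R]_(n, m)) y : (H y)^T = H y ->
  V y -> coframe_on H V th -> (kermx (H y) :=: (th y)^T)%MS.
Proof.
move=> Hs Vy [_ /(_ y Vy)[Hth rk rth]]; have sK : ((th y)^T <= kermx (H y))%MS.
  by apply/sub_kermxP; rewrite -[X in _ *m X]Hs -trmx_mul Hth trmx0.
apply/eqmxP; rewrite sK andbT; have [_ <-] := mxrank_leqif_sup sK.
by rewrite mxrank_tr mxrank_ker rth -[X in (X - _)%N]rk addKn.
Qed.

Lemma coframe_sub H V m (th : 'rV[R]_n -> 'M[R]_(n, m)) y p (u : 'M[R]_(p, n)) :
  (H y)^T = H y -> V y -> coframe_on H V th ->
  (u <= H y)%MS = (u *m th y == 0).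
Proof.
move=> Hs Vy [_ /(_ y Vy)[Hth rk rth]].
apply/idP/eqP => [/submxP[D ->]|uth]; first by rewrite -mulmxA Hth mulmx0.
have HK : (H y <= kermx (th y))%MS by apply/sub_kermxP.
have [_] := mxrank_leqif_sup HK; rewrite mxrank_ker rth -[X in (X - _)%N]rk addnK eqxx.
by move=> /esym; apply: submx_trans; apply/sub_kermxP.
Qed.

Lemma coframe_left_inverse H V m (th : 'rV[R]_n -> 'M[R]_(n, m)) y :
  V y -> coframe_on H V th -> exists u : 'M[R]_(m, n), u *m th y = 1%:M.
Proof.
move=> Vy [_ /(_ y Vy)[_ _ rth]]; exists (pinvmx (th y)).
by rewrite mulVpmx // /row_full rth.
Qed.

Lemma coframe_gram_unit H V m (th : 'rV[R]_n -> 'M[R]_(n, m)) y :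
  V y -> coframe_on H V th -> (th y)^T *m th y \in unitmx.
Proof.
move=> Vy cth; have [u uth] := coframe_left_inverse Vy cth.
apply: posdef_unitmx => w w0; pose z := w *m (th y)^T.
have -> : w *m ((th y)^T *m th y) *m w^T = z *m z^T.
  by rewrite trmx_mul trmxK !mulmxA.
have z0 : z != 0.
  apply: contraNneq w0 => zE; rewrite -[w]mulmx1 -(trmx1 _ m) -uth trmx_mul.
  by rewrite mulmxA -/z zE mul0mx.
exact: mul_tr_gt0.
Qed.

(** If [u] is a left inverse of [th x], then [u *m th y] remains invertible nearby. Multiplying th'
    = th A by the constant [u] then yields a smooth formula for A. *)
Lemma coframe_change H V m (th th' : 'rV[R]_n -> 'M[R]_(n, m)) x :
  open_nbhs x V -> (forall y, V y -> (H y)^T = H y) ->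
  coframe_on H V th -> coframe_on H V th' ->
  exists W (A : 'rV[R]_n -> 'M[R]_m), [/\ open_nbhs x W, W `<=` V, smooth_on W A &
    forall y, W y -> th' y = th y *m A y /\ A y \in unitmx].
Proof.
move=> oV Hs cth cth'; have [_ Vx] := oV.
have [u uth] := coframe_left_inverse Vx cth.
have [oV1 _] := oV.
have su (t : 'rV[R]_n -> 'M[R]_(n, m)) : coframe_on H V t ->
    smooth_on V (fun y => u *m t y).
  move=> [st _] k; apply: (Ck_on_mulmx (f := fun=> u)) (st k) => //.
  exact: Ck_on_cst.
have [|W [oW WV Wu]] := near_unitmx oV (su _ cth); first by rewrite uth unitmx1.
exists W, (fun y => invmx (u *m th y) *m (u *m th' y)); split => //.
  have [oW1 _] := oW => k; apply: Ck_on_mulmx => //.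
    by apply: Ck_on_invmx => //; exact: smooth_onS WV (su _ cth) k.
  exact: smooth_onS WV (su _ cth') k.
move=> y Wy; have Vy := WV _ Wy.
have : ((th' y)^T <= (th y)^T)%MS.
  by rewrite -(coframe_kermx (Hs _ Vy) Vy cth') (coframe_kermx (Hs _ Vy) Vy cth).
move=> /submxP[D /(congr1 trmx)]; rewrite trmx_mul !trmxK => thE.
have E : th' y = th y *m (invmx (u *m th y) *m (u *m th' y)).
  by rewrite thE (mulmxA u) mulKmx // Wu.
split=> //; rewrite -row_full_unit /row_full eqn_leq rank_leq_col /=.
have [_ /(_ y Vy)[_ _ rth']] := cth'; rewrite -[X in (X <= _)%N]rth' [X in (\rank X <= _)%N]E.
exact: mxrankM_maxr.
Qed.


(** By the Leibniz rule; the derivatives of [A] in directions other than [X] occur multiplied by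
    [X *m th x], which is zero. *)
Lemma contraction_change m (th : 'rV[R]_n -> 'M[R]_(n, m)) (A : 'rV[R]_n -> 'M[R]_m) x X :
  differentiable th x -> differentiable A x ->
  differentiable (fun y => th y *m A y) x -> X *m th x = 0 ->
  contraction (dform (fun y => th y *m A y) x) X =
    (A x)^T *m contraction (dform th x) X + ('D_X A x)^T *m (th x)^T.
Proof.
move=> dth dA dthA Xth; rewrite !contraction_dform //.
rewrite mulmxBr (derive_mulmx X dth dA) linearD /= !trmx_mul addrAC; congr (_ - _ + _).
apply/matrixP => c q; rewrite [LHS]mxE (derive_mulmx _ dth dA) mulmxDr.
rewrite !mulmxA Xth mul0mx addr0 [LHS]mxE [RHS]mxE.
by apply: eq_bigr => b _; rewrite [X in _ = X * _]mxE [X in _ = _ * X]mxE mulrC.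
Qed.

Lemma near_eq_dform m (th th' : 'rV[R]_n -> 'M[R]_(n, m)) x :
  (\forall y \near x, th y = th' y) -> dform th x = dform th' x.
Proof.
move=> tt; have E v : 'D_v th x = 'D_v th' x by exact: near_eq_derive.
apply/funext => a; apply/matrixP => i j; rewrite [LHS]mxE [RHS]mxE.
by rewrite (E (delta_mx 0 i)) (E (delta_mx 0 j)).
Qed.

Lemma canonical_at_unique H V x G G' : open_nbhs x V ->
  (forall y, V y -> (H y)^T = H y) -> smooth_on V H -> regular_at H x ->
  canonical_at H x G -> canonical_at H x G' -> G = G'.
Proof.
move=> oV Hs sH reg [m [th [V1 [v [oV1 cth vth ev GM]]]]].
move=> [m' [th' [V2 [v' [oV2 cth' vth' ev' GM']]]]].
have mE : m = m'.
  have [_ /(_ x oV1.2)[_ r1 _]] := cth; have [_ /(_ x oV2.2)[_ r2 _]] := cth'.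
  by apply/eqP; rewrite -(eqn_add2l (\rank (H x))) r1 r2.
subst m'.
pose W0 := V `&` V1 `&` V2.
have oW0 : open_nbhs x W0.
  split; first exact: openI (openI oV.1 oV1.1) oV2.1.
  by split; [split; [exact: oV.2|exact: oV1.2]|exact: oV2.2].
have Hs0 y : W0 y -> (H y)^T = H y by move=> [[/Hs]].
have c0 : coframe_on H W0 th by apply: coframe_onS cth => y [[]].
have c0' : coframe_on H W0 th' by apply: coframe_onS cth' => y [].
have [W [A [oW WW0 sA thE]]] := coframe_change oW0 Hs0 c0 c0'.
have [oW1 Wx] := oW.
have cW : coframe_on H W th by exact: coframe_onS c0.
have cW' : coframe_on H W th' by exact: coframe_onS c0'.
have [sth Vth] := cW; have [sth' Vth'] := cW'.
have [thEx uA] := thE _ Wx.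
have HsW y : W y -> (H y)^T = H y by move=> /WW0/Hs0.
have sHW : smooth_on W H by apply: smooth_onS sH => y /WW0[[]].
have TA y X : W y -> X *m th y = 0 ->
  contraction (dform th' y) X =
    (A y)^T *m contraction (dform th y) X + ('D_X A y)^T *m (th y)^T.
  move=> Wy Xth.
  have dth := smooth_differentiable sth Wy; have dA := smooth_differentiable sA Wy.
  have near_th : \forall z \near y, th' z = th z *m A z.
    by near=> z; apply: (thE z _).1; near: z; exact: open_nbhs_nbhs.
  have dthA : differentiable (fun z => th z *m A z) y.
    exact: near_eq_differentiable near_th (smooth_differentiable sth' Wy).
  by rewrite (near_eq_dform near_th); exact: contraction_change.
have KE y : W y -> cometric_field H th' y = (A y)^T *m cometric_field H th y *m A y.
  move=> Wy; have [Hth _ _] := Vth _ Wy.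
  apply: (@cometric_change _ _ _ _ _ _ (th y) _ (fun X => 'D_X A y)) => // [|X].
    exact: HsW.
  exact: TA.
have [pK inj] := reg _ _ _ oW cW; have [pK' inj'] := reg _ _ _ oW cW'.
have uK := posdef_unitmx pK.
have sK := cometric_smooth oW1 sHW sth.
have dA := smooth_differentiable sA Wx; have dK := smooth_differentiable sK Wx.
(* Both sides solve the equation of [th'] at [x] with the same normalisation. *)
have vE : v' = (A x)^T *m v.
  apply: (splitting_eq_unique inj' _ ev').
    by rewrite vth' thEx mulmxA -(mulmxA _ v) vth KE.
  have [Hth _ _] := Vth _ Wx.
  apply: (@splitting_eq_change _ _ _ (H x) (dform th x) (dform th' x) (th x) (A x)
    (fun X => 'D_X A x) (HsW _ Wx) Hth uA (TA x ^~ Wx) uK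
    (cometric_diff H th x) (cometric_diff H th' x) v vth _ ev).
  move=> X _.
  have near_K : \forall z \near x,
      cometric_field H th' z = (A z)^T *m cometric_field H th z *m A z.
    by near=> z; apply: KE; near: z; exact: open_nbhs_nbhs.
  have sK' := cometric_smooth oW1 sHW sth'.
  rewrite /= (cometric_diffE X dK) (cometric_diffE X (smooth_differentiable sK' Wx)).
  have sAT : smooth_on W (fun z => (A z)^T) by move=> k; exact: Ck_on_tr.
  have sATK : smooth_on W (fun z => (A z)^T *m cometric_field H th z).
    by move=> k; exact: Ck_on_mulmx (sAT k) (sK k).
  apply: etrans (near_eq_derive X near_K) _.
  apply: etrans (derive_mulmx X (smooth_differentiable sATK Wx) dA) _.
  congr (_ + _); rewrite -mulmxDl; congr (_ *m _).
  apply: etrans (derive_mulmx X (smooth_differentiable sAT Wx) dK) _.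
  by congr (_ *m _ + _); exact: derive_trmx.
apply: (can_inj (mulmxK (mulmx1_unit GM).2)); rewrite GM -GM' KE // vE.
congr (_ *m (_ + _)).
have uAT : (A x)^T \in unitmx by rewrite unitmx_tr.
have uKA : (A x)^T *m cometric_field H th x *m A x \in unitmx.
  by rewrite !unitmx_mul uAT uK uA.
have uAK : (A x)^T *m cometric_field H th x \in unitmx.
  by rewrite unitmx_mul uAT uK.
have -> : invmx (cometric_field H th x) = A x *m
    invmx ((A x)^T *m cometric_field H th x *m A x) *m (A x)^T.
  apply: (can_inj (mulKmx uAK)).
  by rewrite [LHS]mulmxK // !mulmxA mulmxV // mul1mx.
by rewrite trmx_mul trmxK !mulmxA.
Unshelve. all: by end_near. Qed.

End Coframes.

(** * Smooth solutions of the equation *)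

Section Existence.
Variables (R : realType) (n : nat).
Implicit Types (H : 'rV[R]_n -> 'M[R]_n) (V W : set 'rV[R]_n).

Lemma Ck_on_scale (U : normedModType R) p q k (S : set U) (f : U -> R) (g : U -> 'M[R]_(p, q)) :
  open S -> Ck_on k S f -> Ck_on k S g -> Ck_on k S (fun y => f y *: g y).
Proof.
move=> oS cf cg; apply: Ck_on_mx => // i j.
have := Ck_onM oS cf (Ck_on_coord i j oS cg).
by apply: Ck_on_eq => // y _; rewrite mxE.
Qed.

Lemma exists_unit_minor p q (S : 'M[R]_(p, q)) :
  exists (A : 'M[R]_(\rank S, p)) (B : 'M[R]_(q, \rank S)), A *m S *m B = 1%:M.
Proof.
exists (pinvmx (col_base S)), (pinvmx (row_base S)).
transitivity ((pinvmx (col_base S) *m col_base S) *m (row_base S *m pinvmx (row_base S))).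
  by rewrite mulmxA -[in RHS](mulmxA (pinvmx (col_base S))) mulmx_base.
by rewrite mulVpmx ?col_base_full // mulmxVp ?row_base_free // mulmx1.
Qed.

Lemma coframe_exists H V x : open_nbhs x V -> smooth_on V H ->
  (forall y, V y -> \rank (H y) = \rank (H x)) ->
  exists m (th : 'rV[R]_n -> 'M[R]_(n, m)) W,
    [/\ open_nbhs x W, W `<=` V & coframe_on H W th].
Proof.
move=> oV sH rH.
have [A0 [B0 AHB]] := exists_unit_minor (H x).
have [oV1 Vx] := oV.
have sE : smooth_on V (fun y => A0 *m H y).
  by move=> k; apply: (Ck_on_mulmx (f := fun=> A0)) (sH k) => //; exact: Ck_on_cst.
have sEB : smooth_on V (fun y => A0 *m H y *m B0).
  by move=> k; apply: (Ck_on_mulmx (g := fun=> B0)) (sE k) _ => //; exact: Ck_on_cst.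
have [|W1 [oW1 W1V uW1]] := near_unitmx oV sEB; first by rewrite AHB unitmx1.
pose m := \rank (cokermx (H x)).
have [th0 [u [Hth0 uth0]]] : exists (t : 'M[R]_(n, m)) (u : 'M[R]_(m, n)),
    H x *m t = 0 /\ u *m t = 1%:M.
  pose C := cokermx (H x); exists (col_base C), (pinvmx (col_base C)).
  split; last by rewrite mulVpmx // col_base_full.
  have : H x *m col_base C *m row_base C = 0 by rewrite -mulmxA mulmx_base mulmx_coker.
  move=> /(congr1 (mulmx^~ (pinvmx (row_base C)))).
  by rewrite -(mulmxA _ (row_base C)) mulmxVp ?row_base_free // mulmx1 mul0mx.
(* The projection of [th0] to the kernel of [A0 *m H y] along the column space of [B0]; at [x] it
   fixes [th0]. *)
pose th y := th0 - B0 *m invmx (A0 *m H y *m B0) *m (A0 *m H y *m th0).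
have oW1' : open W1 by case: oW1.
have sth : smooth_on W1 th.
  move=> k; apply: Ck_onD => //; first exact: Ck_on_cst.
  apply: Ck_onN => //; apply: Ck_on_mulmx => //.
    apply: (Ck_on_mulmx (f := fun=> B0)) => //; first exact: Ck_on_cst.
    by apply: Ck_on_invmx => //; exact: smooth_onS W1V sEB k.
  apply: (Ck_on_mulmx (g := fun=> th0)) => //; last exact: Ck_on_cst.
  exact: smooth_onS W1V sE k.
have suth : smooth_on W1 (fun y => u *m th y).
  by move=> k; apply: (Ck_on_mulmx (f := fun=> u)) (sth k) => //; exact: Ck_on_cst.
have [|W [oW WW1 uW]] := near_unitmx oW1 suth.
  have Eth0 : A0 *m H x *m th0 = 0 by rewrite -mulmxA Hth0 mulmx0.
  by rewrite /th Eth0 mulmx0 subr0 uth0 unitmx1.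
exists m, th, W; split=> //; first exact: subset_trans W1V.
split; first exact: smooth_onS sth.
move=> y Wy; have W1y := WW1 _ Wy; have Vy := W1V _ W1y.
have Eth : A0 *m H y *m th y = 0.
  by rewrite mulmxBr !(mulmxA (A0 *m H y)) mulmxV ?uW1 // mul1mx subrr.
(* Constancy of the rank enters here: the selected combinations of rows of [H y] stay independent
   and so still span D. *)
have EH : (H y <= A0 *m H y)%MS.
  have sEH : (A0 *m H y <= H y)%MS by exact: submxMl.
  have [_ <-] := mxrank_leqif_sup sEH; rewrite eqn_leq mxrankM_maxr /= rH //.
  by rewrite -[X in (X <= _)%N](mxrank_unit (uW1 _ W1y)) mxrankM_maxl.
split.
- by case/submxP: EH => D ->; rewrite -mulmxA Eth mulmx0.
- by rewrite rH // /m mxrank_coker subnKC // rank_leq_row.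
- apply/eqP; rewrite eqn_leq rank_leq_col /=.
  by rewrite -[X in (X <= _)%N](mxrank_unit (uW _ Wy)) mxrankM_maxr.
Qed.

(** Both summands are semidefinite. A covector on which the first vanishes is a combination b of the
    coframe, and the normalisation turns the second into b K b^T. *)
Lemma coframe_metric_posdef H V m (th : 'rV[R]_n -> 'M[R]_(n, m)) y (v : 'M[R]_(m, n)) K :
  V y -> coframe_on H V th -> (H y)^T = H y ->
  (forall u : 'rV[R]_n, u *m H y != 0 -> 0 < (u *m H y *m u^T) 0 0) ->
  posdef_mx K -> K^T = K -> v *m th y = K ->
  posdef_mx (H y + v^T *m invmx K *m v).
Proof.
move=> Vy cth Hs Hpos pK Ks vth u u0; have uK := posdef_unitmx pK.
have Kiv (w : 'rV[R]_m) : w != 0 -> 0 < (w *m invmx K *m w^T) 0 0.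
  move=> w0; have := pK (w *m invmx K).
  rewrite trmx_mul trmx_inv Ks !mulmxA mulmxKV //; apply.
  by apply: contraNneq w0 => wE; rewrite -[w](mulmxKV uK) wE mul0mx.
have Ki0 (w : 'rV[R]_m) : 0 <= (w *m invmx K *m w^T) 0 0.
  have [->|w0] := eqVneq w 0; first by rewrite !mul0mx mxE.
  exact/ltW/Kiv.
have -> : (u *m (H y + v^T *m invmx K *m v) *m u^T) 0 0 =
    (u *m H y *m u^T) 0 0 + ((u *m v^T) *m invmx K *m (u *m v^T)^T) 0 0.
  by rewrite mulmxDr mulmxDl mxE trmx_mul trmxK !mulmxA.
have [uH|uH] := eqVneq (u *m H y) 0; last by rewrite ltr_wpDr // Hpos.
rewrite uH mul0mx mxE add0r; apply: Kiv.
have : (u <= (th y)^T)%MS.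
  by rewrite -(coframe_kermx Hs Vy cth); apply/sub_kermxP.
move=> /submxP[b ub]; rewrite ub -mulmxA -trmx_mul vth Ks.
apply: contraNneq u0 => bK; rewrite ub -[b](mulmxK uK) bK !mul0mx.
by [].
Qed.

Lemma posdef_invmx k (M : 'M[R]_k) : M^T = M -> posdef_mx M -> posdef_mx (invmx M).
Proof.
move=> Ms pM w w0; have uM := posdef_unitmx pM; have := pM (w *m invmx M).
rewrite trmx_mul trmx_inv Ms !mulmxA mulmxKV //; apply.
by apply: contraNneq w0 => wE; rewrite -[w](mulmxKV uM) wE mul0mx.
Qed.

(** Writing M for the inverted matrix, the product M^-1 H is the projection to D along the
    complement, and H absorbs it. The resulting identity H G H = H says that the metric G restricts
    to h on D. *)
Lemma coframe_metric_extends H V m (th : 'rV[R]_n -> 'M[R]_(n, m)) y (v : 'M[R]_(m, n)) K :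
  V y -> coframe_on H V th -> K \in unitmx -> K^T = K -> v *m th y = K ->
  H y + v^T *m invmx K *m v \in unitmx -> (H y)^T = H y ->
  H y *m invmx (H y + v^T *m invmx K *m v) *m H y = H y.
Proof.
move=> Vy [_ /(_ y Vy)[Hth _ _]] uK Ks vth uM Hs; set M := H y + _ in uM *.
have Mth : M *m th y = v^T.
  by rewrite mulmxDl Hth add0r -mulmxA vth mulmxKV.
have MH : invmx M *m H y = 1%:M - th y *m invmx K *m v.
  apply: (can_inj (mulKmx uM)); rewrite mulKVmx // mulmxBr mulmx1 !mulmxA Mth.
  by rewrite addrK.
by rewrite -mulmxA MH mulmxBr mulmx1 !mulmxA Hth !mul0mx subr0.
Qed.

Lemma levi_trace_mx_smooth V m (Hf : 'rV[R]_n -> 'M[R]_n) (T : 'rV[R]_n -> 'I_m -> 'M[R]_n)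
    (N : 'rV[R]_n -> 'rV[R]_n -> 'M[R]_m) k : open V ->
  (forall c, Ck_on k V (fun y => raised_levi (Hf y) (T y) c)) ->
  (forall X, Ck_on k V X -> Ck_on k V (fun y => N y (X y))) ->
  Ck_on k V (fun y => levi_trace_mx (Hf y) (T y) (N y)).
Proof.
move=> oV cphi cN; apply: Ck_on_mx => // p d.
have : Ck_on k V (fun y => \sum_c N y (delta_mx 0 p *m raised_levi (Hf y) (T y) c) c d).
  apply: Ck_on_sum => // c _; apply: Ck_on_coord => //; apply: cN.
  by apply: (Ck_on_mulmx (f := fun=> _)) => //; exact: Ck_on_cst.
by apply: Ck_on_eq => // y _; rewrite !mxE.
Qed.

Section Smoothness.
Variables (H : 'rV[R]_n -> 'M[R]_n) (V : set 'rV[R]_n) (m : nat).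
Variable (th : 'rV[R]_n -> 'M[R]_(n, m)).
Hypotheses (oV : open V) (sH : smooth_on V H) (sth : smooth_on V th).
Hypothesis uK : forall y, V y -> cometric_field H th y \in unitmx.

Lemma raised_levi_smooth c : smooth_on V (fun y => raised_levi (H y) (dform th y) c).
Proof.
move=> k; apply: Ck_on_sum => // a _; apply: Ck_on_scale => //.
  apply: Ck_on_coord => //; apply: Ck_on_invmx => //.
  exact: cometric_smooth.
apply: Ck_on_mulmx (sH k) => //; apply: Ck_on_mulmx (sH k) _ => //.
exact: (dform_smooth a oV sth k).
Qed.

Lemma cometric_diff_smooth X k : Ck_on k V X -> Ck_on k V (fun y => cometric_diff H th y (X y)).
Proof.
move=> cX; apply: Ck_on_sum => // q _; apply: Ck_on_scale => //.
  exact: Ck_on_coord.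
exact: (Ck_on_derive _ (cometric_smooth oV sH sth k.+1)).
Qed.

Lemma symbol_smooth X v k : Ck_on k V X -> Ck_on k V (fun y => symbol (dform th y) v (X y)).
Proof.
move=> cX.
have cC : Ck_on k V (fun y => contraction (dform th y) (X y) *m v^T).
  apply: (Ck_on_mulmx (g := fun=> v^T)) => //; last exact: Ck_on_cst.
  apply: Ck_on_mx => // c q.
  have := Ck_on_coord 0 q oV (Ck_on_mulmx oV cX (dform_smooth c oV sth k)).
  by apply: Ck_on_eq => // y _; rewrite [RHS]mxE.
exact: Ck_onD oV cC (Ck_on_tr oV cC).
Qed.

Lemma splitting_sol_smooth :
  (forall y, V y -> lin_mx (splitting_op (H y) (dform th y) (th y)) \in unitmx) ->
  smooth_on V (fun y => splitting_sol (H y) (dform th y) (th y) (cometric_diff H th y)).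
Proof.
move=> uL k.
have crl c : Ck_on k V (fun y => raised_levi (H y) (dform th y) c) by exact: raised_levi_smooth.
have cth : Ck_on k V (fun y => (th y)^T) by apply: Ck_on_tr; [|exact: sth].
have cop v : Ck_on k V (fun y => splitting_op (H y) (dform th y) (th y) v).
  apply: Ck_onD => //.
    apply: (Ck_on_mulmx (f := fun=> v)) => //; first exact: Ck_on_cst.
    by apply: Ck_on_mulmx => //; exact: sth.
  apply: Ck_on_tr => //; apply: levi_trace_mx_smooth => // X; exact: symbol_smooth.
have crhs : Ck_on k V (fun y => splitting_rhs (H y) (dform th y) (th y) (cometric_diff H th y)).
  apply: Ck_onD => //.
    by apply: Ck_on_mulmx => //; exact: (cometric_smooth oV sH sth k).
  apply: Ck_on_tr => //; apply: levi_trace_mx_smooth => // X; exact: cometric_diff_smooth.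
have clin : Ck_on k V (fun y => lin_mx (splitting_op (H y) (dform th y) (th y))).
  apply: Ck_on_mx => // i j; case/mxvec_indexP: j => p q.
  have := Ck_on_coord p q oV (cop (vec_mx (delta_mx 0 i))).
  by apply: Ck_on_eq => // y _; rewrite [RHS]mxE [RHS]mxvecE.
have cvec : Ck_on k V (fun y =>
    mxvec (splitting_rhs (H y) (dform th y) (th y) (cometric_diff H th y))).
  apply: Ck_on_mx => // i j; case/mxvec_indexP: j => p q.
  have := Ck_on_coord p q oV crhs.
  by apply: Ck_on_eq => // y _; rewrite ord1 mxvecE.
apply: Ck_on_mx => // p q.
have cinv : Ck_on k V (fun y => invmx (lin_mx (splitting_op (H y) (dform th y) (th y)))).
  exact: Ck_on_invmx.
have := Ck_on_coord 0 (mxvec_index p q) oV (Ck_on_mulmx oV cvec cinv).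
by apply: Ck_on_eq => // y _; rewrite /splitting_sol [RHS]mxE.
Qed.

End Smoothness.
End Existence.

(** * Local existence and naturality of the metric *)

Section CanonicalMetric.
Variables (R : realType).

(** One coframe serves all points of a neighbourhood, and the solution of an invertible linear
    system depends smoothly on its coefficients. *)
Lemma canonical_exists n (H : 'rV[R]_n -> 'M[R]_n) V x :
  open_nbhs x V -> smooth_on V H -> (forall y, V y -> (H y)^T = H y) ->
  (forall y, V y -> \rank (H y) = \rank (H x)) ->
  (forall y (u : 'rV[R]_n), V y -> u *m H y != 0 -> 0 < (u *m H y *m u^T) 0 0) ->
  (forall y, V y -> regular_at H y) ->
  exists W G, [/\ open_nbhs x W, smooth_on W G & forall y, W y ->
    [/\ canonical_at H y (G y), (G y)^T = G y, posdef_mx (G y)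
      & H y *m G y *m H y = H y]].
Proof.
move=> oV sH Hs rH Hpos reg.
have [m [th [W [oW WV cth]]]] := coframe_exists oV sH rH.
have [oW1 Wx] := oW.
pose K y := cometric_field H th y.
pose v y := splitting_sol (H y) (dform th y) (th y) (cometric_diff H th y).
pose M y := H y + (v y)^T *m invmx (K y) *m v y.
have pK y : W y -> posdef_mx (K y).
  by move=> Wy; have [] := reg _ (WV _ Wy) _ _ _ (conj oW1 Wy) cth.
have inj y : W y -> injective_at (H y) (dform th y) (th y).
  by move=> Wy; have [] := reg _ (WV _ Wy) _ _ _ (conj oW1 Wy) cth.
have vP y : W y -> v y *m th y = K y /\
    splitting_eq (H y) (dform th y) (cometric_diff H th y) (v y).
  move=> Wy; have [Hth _ _] := cth.2 _ Wy.
  apply: splitting_solP; [exact/Hs/WV|exact: Hth|exact: coframe_gram_unit cth|exact: inj].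
have Ks y : (K y)^T = K y by exact: cometric_sym.
have pM y : W y -> posdef_mx (M y).
  move=> Wy; apply: (coframe_metric_posdef Wy cth) => //; first exact/Hs/WV.
  - by move=> u; apply: Hpos; exact: WV.
  - exact: pK.
  - by have [] := vP _ Wy.
have Ms y : W y -> (M y)^T = M y.
  by move=> Wy; rewrite linearD /= (Hs _ (WV _ Wy)) !trmx_mul trmxK trmx_inv Ks mulmxA.
have uM y : W y -> M y \in unitmx by move=> /pM/posdef_unitmx.
have uK y : W y -> K y \in unitmx by move=> /pK/posdef_unitmx.
have sHW : smooth_on W H by exact: smooth_onS sH.
have sth := cth.1.
have sv : smooth_on W v.
  apply: splitting_sol_smooth => // y Wy; apply: lin_splitting_op_unit.
  - exact/Hs/WV.
  - by have [] := cth.2 _ Wy.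
  - exact: coframe_gram_unit cth.
  - exact: inj.
exists W, (fun y => invmx (M y)); split=> //.
  move=> k; apply: Ck_on_invmx => //; apply: Ck_onD => //.
  apply: Ck_on_mulmx (sv k) => //; apply: Ck_on_mulmx => //.
    by apply: Ck_on_tr => //; exact: sv.
  by apply: Ck_on_invmx => //; exact: cometric_smooth.
move=> y Wy; have [vth ev] := vP _ Wy; split.
- exists m, th, W, (v y); split=> //.
  by rewrite mulVmx // uM.
- by rewrite trmx_inv Ms.
- by apply: posdef_invmx; [exact: Ms|exact: pM].
- apply: (coframe_metric_extends Wy cth) => //; [exact: uK|exact: uM|exact/Hs/WV].
Qed.

Lemma jacobian_smooth n n' (F : 'rV[R]_n -> 'rV[R]_n') V : open V -> smooth_on V F ->
  smooth_on V (jacobian F).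
Proof.
move=> oV sF k; apply: Ck_on_mx => // i j.
have := Ck_on_coord 0 j oV (Ck_on_derive (delta_mx 0 i) (sF k.+1)).
apply: Ck_on_eq => // y Vy.
rewrite (deriveEjacobian _ (smooth_differentiable sF Vy)).
by rewrite -rowE mxE.
Qed.

(** In the application [S] collects the terms with second derivatives of the map, which are
    symmetric and disappear. *)
Lemma antisymmetrize_mulmx n n' (J : 'M[R]_(n, n')) (S d : 'I_n -> 'I_n -> R)
    (D : 'I_n' -> 'I_n' -> R) :
  (forall p q, d p q = S p q + \sum_s \sum_t J p t * J q s * D t s) ->
  (forall p q, S p q = S q p) ->
  \matrix_(p, q) (d p q - d q p) = J *m (\matrix_(i, j) (D i j - D j i)) *m J^T.
Proof.
move=> dE Ss; apply/matrixP => p q; rewrite [LHS]mxE !dE (Ss p q).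
rewrite opprD addrACA subrr add0r [X in _ - X]exchange_big -sumrB [RHS]mxE /=.
apply: eq_bigr => j _; rewrite [X in _ = X * _]mxE [X in _ = _ * X]mxE mulr_suml -sumrB.
by apply: eq_bigr => i _; rewrite [X in _ = _ * X * _]mxE; ring.
Qed.

Lemma dform_pullback n n' m (F : 'rV[R]_n -> 'rV[R]_n') (th : 'rV[R]_n' -> 'M[R]_(n', m))
    V x c : open V -> V x -> smooth_on V F -> differentiable th (F x) ->
  dform (fun y => jacobian F y *m th (F y)) x c =
  jacobian F x *m dform th (F x) c *m (jacobian F x)^T.
Proof.
move=> oV Vx sF dth.
have dF := smooth_differentiable sF Vx.
have dJ := smooth_differentiable (jacobian_smooth oV sF) Vx.
have dthF : differentiable (th \o F) x by exact: differentiable_comp.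
set J := jacobian F x.
have DthF p : 'D_(delta_mx 0 p) (th \o F) x = \sum_t J p t *: 'D_(delta_mx 0 t) th (F x).
  rewrite deriveE // diff_comp //= -(deriveE _ dF) -(deriveE _ dth).
  rewrite (deriveEjacobian _ dF) (derive_sum_coord _ dth).
  by apply: eq_bigr => t _; rewrite -rowE mxE.
(* Schwarz's theorem for the components of [F], which makes d commute with pullback. *)
have sw p q s : 'D_(delta_mx 0 p) (jacobian F) x q s = 'D_(delta_mx 0 q) (jacobian F) x p s.
  have E a b : 'D_(delta_mx 0 a) (jacobian F) x b s =
      'D_(delta_mx 0 a) ('D_(delta_mx 0 b) F) x 0 s.
    have dD : differentiable ('D_(delta_mx 0 b) F) x.
      by have [_ /(_ (delta_mx 0 b))[dD _]] := sF 2%N; exact: dD.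
    apply: etrans (derive_coord _ _ _ dJ) _; apply: etrans _ (esym (derive_coord _ _ _ dD)).
    apply: near_eq_derive; near=> y.
    have Vy : V y by near: y; exact: open_nbhs_nbhs.
    by rewrite (deriveEjacobian _ (smooth_differentiable sF Vy)) -rowE [RHS]mxE.
  apply: etrans (E p q) _; apply: etrans _ (esym (E q p)).
  have dd := derive_swap (delta_mx 0 p) (delta_mx 0 q) oV Vx (sF 2%N).
  by apply: (f_equal (fun M : 'M[R]_(1, n') => M 0 s) dd).
have Dth p q : 'D_(delta_mx 0 p) (fun y => jacobian F y *m th (F y)) x q c =
    \sum_s 'D_(delta_mx 0 p) (jacobian F) x q s * th (F x) s c +
    \sum_s \sum_t J p t * J q s * 'D_(delta_mx 0 t) th (F x) s c.
  have -> : 'D_(delta_mx 0 p) (fun y => jacobian F y *m th (F y)) x =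
      'D_(delta_mx 0 p) (jacobian F) x *m th (F x) + J *m 'D_(delta_mx 0 p) (th \o F) x.
    exact: derive_mulmx.
  rewrite [LHS]mxE [X in X + _]mxE; congr (_ + _).
  rewrite [LHS]mxE DthF; apply: eq_bigr => s _; rewrite summxE mulr_sumr.
  by apply: eq_bigr => t _; rewrite [X in _ * X]mxE mulrCA mulrA.
apply: (antisymmetrize_mulmx (d := fun p q => 'D_(delta_mx 0 p)
  (fun y => jacobian F y *m th (F y)) x q c) (D := fun t s => 'D_(delta_mx 0 t) th (F x) s c)
  Dth) => p q.
by apply: eq_bigr => s _; congr (_ * _); exact: sw.
Unshelve. all: by end_near. Qed.

End CanonicalMetric.

(** * Invariance under local diffeomorphisms *)

Section Pullback.
Variables (R : realType).

Lemma open_preimage (U W : topologicalType) (f : U -> W) (V : set U) (V' : set W) :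
  open V -> open V' -> (forall x, V x -> {for x, continuous f}) ->
  open (V `&` f @^-1` V').
Proof.
move=> oV oV' cf; rewrite openE => y [Vy V'fy]; apply: filterI.
  exact: open_nbhs_nbhs.
by apply: (cf y Vy); exact: open_nbhs_nbhs.
Qed.

(** Cyclicity of the trace moves [J] from the forms to the bivectors. A rectangular [J] is allowed:
    besides Jacobians, it will be a frame of D. *)
Lemma cometric_pullback n n' m (H : 'M[R]_n) (H' : 'M[R]_n') (J : 'M[R]_(n, n'))
    (T : 'I_m -> 'M[R]_n) (T' : 'I_m -> 'M[R]_n') :
  H' = J^T *m H *m J -> (forall c, T c = J *m T' c *m J^T) ->
  cometric H T = cometric H' T'.
Proof.
move=> H'E TE; apply/matrixP => a b; rewrite !mxE; congr (_ * _).
rewrite !TE H'E -!mulmxA mxtrace_mulC -!mulmxA.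
by [].
Qed.

Lemma levi_trace_pullback n n' m (H : 'M[R]_n) (H' : 'M[R]_n') (J : 'M[R]_(n, n'))
    (J' : 'M[R]_(n', n)) (T : 'I_m -> 'M[R]_n) (T' : 'I_m -> 'M[R]_n') N N' Z :
  H' = J^T *m H *m J -> J *m J' = 1%:M -> (forall c, T c = J *m T' c *m J^T) ->
  (forall X, N X = N' (X *m J)) ->
  levi_trace H T N Z = levi_trace H' T' N' (Z *m J'^T).
Proof.
move=> H'E JJ' TE NE; apply/rowP => d; rewrite !mxE; apply: eq_bigr => c _.
rewrite NE; congr (N' _ _ _); rewrite -!mulmxA; congr (_ *m _).
rewrite /raised_levi mulmx_suml mulmx_sumr; apply: eq_bigr => a _.
rewrite -scalemxAl -scalemxAr (cometric_pullback H'E TE); congr (_ *: _).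
by rewrite TE H'E !mulmxA -trmx_mul JJ' trmx1 mul1mx.
Qed.

Lemma canonical_at_pullback n n' (H : 'rV[R]_n -> 'M[R]_n) (H' : 'rV[R]_n' -> 'M[R]_n')
    (F : 'rV[R]_n -> 'rV[R]_n') V V' x G :
  open_nbhs x V -> open V' -> (forall y, V y -> V' (F y)) ->
  smooth_on V F -> smooth_on V' H' -> (forall y, V y -> (H y)^T = H y) ->
  (forall y, V y -> H' (F y) = (jacobian F y)^T *m H y *m jacobian F y) ->
  (forall y, V y -> exists J', jacobian F y *m J' = 1%:M /\ J' *m jacobian F y = 1%:M) ->
  canonical_at H' (F x) G ->
  canonical_at H x (jacobian F x *m G *m (jacobian F x)^T).
Proof.
move=> [oV Vx] oV' FV sF sH' Hs H'E invJ [m [th' [V1 [v' [[oV1 V1F] cth' vth' ev' GM]]]]].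
(* An invertible Jacobian forces equal dimensions; after identifying them, [invmx] is available. *)
have nE : n = n'.
  have [J' [J1 J2]] := invJ _ Vx.
  by apply/eqP; rewrite eqn_leq (mulmx1_min J1) (mulmx1_min J2).
subst n'.
have uJ y : V y -> jacobian F y \in unitmx by move=> /invJ[J' [/mulmx1_unit[]]].
pose W := V `&` F @^-1` (V' `&` V1).
have oW : open W.
  apply: open_preimage (openI oV' oV1) _ => // y Vy.
  exact: (sF 0%N y Vy).
have Wx : W x by split=> //; split=> //; exact: FV.
pose th y := jacobian F y *m th' (F y).
have sJ := jacobian_smooth oV sF.
have WV : W `<=` V by move=> y [].
have sth'F : smooth_on W (th' \o F).
  move=> k; apply: (Ck_on_comp oW oV1 (f := F)); last exact: cth'.1.
    by move=> y [_ []].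
  exact: smooth_onS WV sF k.
have sth : smooth_on W th.
  by move=> k; apply: Ck_on_mulmx (sth'F k) => //; exact: smooth_onS WV sJ k.
have HE y : V y -> H y = (invmx (jacobian F y))^T *m H' (F y) *m invmx (jacobian F y).
  move=> Vy; rewrite H'E // !mulmxA -trmx_mul mulmxV ?uJ // trmx1 mul1mx.
  by rewrite mulmxK ?uJ.
have cth : coframe_on H W th.
  split=> // y [Vy [V'Fy V1Fy]]; have [Hth rH rth] := cth'.2 _ V1Fy.
  split.
  - by rewrite HE // /th mulmxA mulmxKV ?uJ // -mulmxA Hth mulmx0.
  - rewrite HE // mxrankMfree ?row_free_unit ?unitmx_inv ?uJ //.
    rewrite -mxrank_tr trmx_mul trmxK mxrankMfree ?row_free_unit ?unitmx_inv ?uJ //.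
    by rewrite mxrank_tr.
  - rewrite -mxrank_tr trmx_mul mxrankMfree ?mxrank_tr //.
    by rewrite row_free_unit unitmx_tr uJ.
have dth'F y : W y -> differentiable th' (F y).
  by move=> [_ [_ V1y]]; exact: smooth_differentiable cth'.1 V1y.
have dE y c : W y -> dform th y c =
    jacobian F y *m dform th' (F y) c *m (jacobian F y)^T.
  by move=> Wy; exact: dform_pullback oV (WV _ Wy) sF (dth'F _ Wy).
have KE y : W y -> cometric_field H th y = cometric_field H' th' (F y).
  by move=> Wy; apply: cometric_pullback (H'E _ (WV _ Wy)) (fun c => dE y c Wy).
pose K' := cometric_field H' th'.
have sK' : smooth_on (V' `&` V1) K'.
  apply: cometric_smooth; first exact: openI.
    by apply: smooth_onS sH' => y [].
  by apply: smooth_onS cth'.1 => y [].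
have dK' : differentiable K' (F x) by apply: smooth_differentiable sK' _; case: Wx.
have dF : differentiable F x by exact: smooth_differentiable sF Vx.
have near_K : \forall y \near x, (K' \o F) y = cometric_field H th y.
  by near=> y; apply/esym/KE; near: y; exact: open_nbhs_nbhs.
have dK'F : differentiable (K' \o F) x by exact: differentiable_comp.
have dK : differentiable (cometric_field H th) x by exact: near_eq_differentiable dK'F.
have DK X : cometric_diff H th x X = cometric_diff H' th' (F x) (X *m jacobian F x).
  apply: etrans (cometric_diffE X dK) _; apply: etrans _ (esym (cometric_diffE _ dK')).
  apply: etrans (esym (near_eq_derive X near_K)) _.
  rewrite -(deriveEjacobian X dF).
  apply: etrans (deriveE _ dK'F) _; rewrite diff_comp //=.
  by rewrite -(deriveE _ dF) -(deriveE _ dK').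
pose J := jacobian F x; pose Ji := invmx J.
have uJx : J \in unitmx by exact: uJ.
exists m, th, W, (v' *m Ji); split => //.
- by rewrite mulmxA mulmxKV // vth' KE.
- move=> Z; rewrite (levi_trace_pullback (H' := H' (F x)) (J := J) (J' := Ji)
    (T' := dform th' (F x)) (N' := fun X => cometric_diff H' th' (F x) X -
      symmetrized (contraction (dform th' (F x)) X *m v'^T))).
  + exact: ev'.
  + exact: H'E.
  + by rewrite mulmxV.
  + by move=> c; exact: dE.
  move=> X; rewrite DK; congr (_ - symmetrized _).
  apply/row_matrixP => c; rewrite !row_mul !rowK (dE _ c Wx) trmx_mul !mulmxA.
  by rewrite -[_ *m J^T *m _]mulmxA -trmx_mul mulVmx // trmx1 mulmx1.
- have -> : H x + (v' *m Ji)^T *m invmx (cometric_field H th x) *m (v' *m Ji) =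
      Ji^T *m (H' (F x) + v'^T *m invmx (cometric_field H' th' (F x)) *m v') *m Ji.
    by rewrite KE // HE // mulmxDr mulmxDl trmx_mul !mulmxA.
  rewrite !mulmxA -[_ *m J^T *m _]mulmxA -trmx_mul mulVmx // trmx1 mulmx1.
  by rewrite -[J *m G *m _]mulmxA GM mulmx1 mulmxV.
Unshelve. all: by end_near. Qed.

End Pullback.

(** * The Levi form in a frame *)

Section FrameAlgebra.
Variables (R : realType).

(** Induction on the size through the Schur complement of the top left entry. It serves to write
    h^ab as a Frobenius inner product. *)
Lemma cholesky k (S : 'M[R]_k) : S^T = S -> posdef_mx S ->
  exists C : 'M[R]_k, S = C^T *m C.
Proof.
elim: k S => [|k IH] S Ss pS; first by exists 0; apply/matrixP => -[].
pose b : 'rV[R]_k := ursubmx (S : 'M[R]_(1 + k)).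
pose D : 'M[R]_k := drsubmx (S : 'M[R]_(1 + k)).
pose a := S 0 0.
have bT : dlsubmx (S : 'M[R]_(1 + k)) = b^T by rewrite /b trmx_ursub Ss.
have SE : S = block_mx a%:M b b^T D :> 'M[R]_(1 + k).
  rewrite -bT -[LHS](@submxK _ 1 k 1 k); congr block_mx.
  by rewrite [LHS]mx11_scalar !mxE; congr (S _ _)%:M; exact: val_inj.
have quad (x : R) (u : 'rV[R]_k) : (row_mx x%:M u *m S *m (row_mx x%:M u)^T) 0 0 =
    x * a * x + x * (b *m u^T) 0 0 *+ 2 + (u *m D *m u^T) 0 0.
  rewrite SE tr_row_mx (@mul_row_block _ 1 1 k 1 k) (@mul_row_col _ 1 1 k 1).
  rewrite !mulmxDl tr_scalar_mx -!scalar_mxM mul_scalar_mx.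
  rewrite -scalemxAl mul_mx_scalar mxE mxE [X in _ + X]mxE.
  have -> : u *m b^T = (b *m u^T)^T by rewrite trmx_mul trmxK.
  rewrite [in X in _ + X + _]mxE [in X in _ + (X + _)]mxE !mxE.
  by rewrite eqxx mulr1n; ring.
have a0 : 0 < a.
  have : row_mx 1%:M 0 != 0 :> 'M[R]_(1, 1 + k).
    apply/eqP => /(congr1 lsubmx); rewrite row_mxKl linear0.
    by move/matrixP/(_ 0 0)/eqP; rewrite !mxE oner_eq0.
  by move=> /pS; rewrite quad trmx0 !mulmx0 !mxE mulr0 mul0rn !addr0 mul1r mulr1.
have bu (u : 'rV[R]_k) : (u *m (b^T *m b) *m u^T) 0 0 = (b *m u^T) 0 0 ^+ 2.
  rewrite mulmxA -mulmxA mxE big_ord1 expr2; congr (_ * _).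
  by rewrite -[u *m b^T]trmxK trmx_mul trmxK mxE.
have [C CE] : exists C : 'M[R]_k, D - a^-1 *: (b^T *m b) = C^T *m C.
  apply: IH.
    rewrite linearB linearZ /= trmx_mul trmxK; congr (_ - _).
    by rewrite /D trmx_drsub Ss.
  (* The first coordinate that minimises the quadratic form for given [u]; the minimum is the Schur
     complement evaluated at [u]. *)
  move=> u u0; pose x := - (a^-1 * (b *m u^T) 0 0).
  have : row_mx x%:M u != 0 :> 'M[R]_(1, 1 + k).
    by apply: contra u0 => /eqP/(congr1 rsubmx); rewrite row_mxKr linear0 => ->.
  move=> /pS; rewrite quad mulmxBr mulmxBl [X in _ -> 0 < X]mxE [X in _ -> 0 < _ + X]mxE.
  rewrite -scalemxAr -scalemxAl [X in _ -> 0 < _ - X]mxE bu /x.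
  move: (b *m u^T) => bu1; move: (bu1 0 0) ((u *m D *m u^T) 0 0) => p q.
  suff -> : - (a^-1 * p) * a * - (a^-1 * p) + - (a^-1 * p) * p *+ 2 + q = q - a^-1 * p ^+ 2 by [].
  by field; rewrite gt_eqF.
pose s := Num.sqrt a; have s2 : s * s = a by rewrite -expr2 sqr_sqrtr // ltW.
have s0 : s != 0 by rewrite gt_eqF // sqrtr_gt0.
exists (block_mx s%:M (s^-1 *: b) 0 C : 'M[R]_(1 + k)).
rewrite SE (@tr_block_mx _ 1 k 1 k) (@mulmx_block _ 1 k 1 k 1 k).
rewrite tr_scalar_mx !trmx0 !mul0mx !mulmx0 !addr0 -CE -scalar_mxM s2.
rewrite mul_scalar_mx scalerA mulfV // scale1r linearZ /= mul_mx_scalar scalerA mulfV //.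
rewrite scale1r -scalemxAl -scalemxAr scalerA -invfM s2 addrC subrK.
by [].
Qed.

Lemma mxtrace_opp k (A : 'M[R]_k) : \tr (- A) = - \tr A.
Proof. exact: raddfN. Qed.

Variables (k m : nat).
Implicit Types (hD S w : 'M[R]_k) (L : 'I_m -> 'I_k -> 'I_k -> R).

Definition levi_mx L (a : 'I_m) : 'M[R]_k := \matrix_(i, j) L a i j.

Definition antisymmetric_levi L := forall a, (levi_mx L a)^T = - levi_mx L a.

Lemma levi_wedgeE L w a : levi_wedge L w 0 a = 2^-1 * \tr (levi_mx L a *m w^T).
Proof.
rewrite mxE; congr (_ * _); apply: eq_bigr => i _.
by rewrite [RHS]mxE; apply: eq_bigr => j _; rewrite !mxE.
Qed.

Lemma wedge_metricE hD w w' : wedge_metric hD w w' = 2^-1 * \tr (w^T *m hD *m w' *m hD^T).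
Proof.
congr (_ * _); rewrite /mxtrace exchange_big /=; apply: eq_bigr => j _.
rewrite [RHS]mxE.
transitivity (\sum_j' (w^T *m hD *m w') j j' * hD j j').
  rewrite (eq_bigr (fun i => \sum_j' \sum_i' hD i i' * hD j j' * w i j * w' i' j')); last first.
    by move=> i _; exact: exchange_big.
  rewrite exchange_big /=; apply: eq_bigr => j' _.
  rewrite exchange_big mxE mulr_suml /=; apply: eq_bigr => i' _.
  rewrite mxE 2!mulr_suml; apply: eq_bigr => i _; rewrite mxE; ring.
by apply: eq_bigr => j' _; rewrite [X in _ = _ * X]mxE.
Qed.

Section Fixed.
Variables (hD : 'M[R]_k) (L : 'I_m -> 'I_k -> 'I_k -> R).
Hypotheses (hDs : hD^T = hD) (hDu : hD \in unitmx) (La : antisymmetric_levi L).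

Local Notation hi := (invmx hD).
Local Notation K := (cometric hi (levi_mx L)).

(** The bivector that represents L^b for the metric on bivectors. Hence it is orthogonal to the
    kernel, and the Gram matrix of these bivectors is [K]; the factor - 1/2 in [cometric] is the 1/2
    of [wedge_metric] with the sign of an antisymmetric transpose. *)
Definition levi_dual b := hi *m levi_mx L b *m hi.

Lemma invmx_sym : hi^T = hi.
Proof. by rewrite trmx_inv hDs. Qed.

Lemma levi_dual_antisym b : antisym (levi_dual b).
Proof. by rewrite /antisym /levi_dual !trmx_mul invmx_sym La mulNmx mulmxN mulmxA. Qed.

Lemma levi_wedge_dual a b : levi_wedge L (levi_dual b) 0 a = K a b.
Proof.
by rewrite levi_wedgeE levi_dual_antisym mulmxN mxtrace_opp mulrN -mulNr mxE !mulmxA.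
Qed.

Lemma wedge_metric_dual b w : antisym w ->
  wedge_metric hD (levi_dual b) w = levi_wedge L w 0 b.
Proof.
move=> wa; rewrite wedge_metricE levi_wedgeE levi_dual_antisym wa hDs; congr (_ * _).
rewrite mulmxN mxtrace_opp !mulNmx mxtrace_opp /levi_dual mulmxKV //; congr (- _).
by rewrite mxtrace_mulC !mulmxA mulmxV // mul1mx.
Qed.

Lemma levi_dual_orth b : levi_ker_orth hD L (levi_dual b).
Proof.
split; first exact: levi_dual_antisym.
by move=> z za z0; rewrite wedge_metric_dual // z0 mxE.
Qed.

Lemma wedge_metricC w w' : wedge_metric hD w w' = wedge_metric hD w' w.
Proof.
rewrite !wedge_metricE; congr (_ * _).
by rewrite -mxtrace_tr !trmx_mul !trmxK hDs mxtrace_mulC !mulmxA.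
Qed.

Lemma antisymB w w' : antisym w -> antisym w' -> antisym (w - w').
Proof. by rewrite /antisym linearB /= => -> ->; rewrite opprB opprK addrC. Qed.

Lemma levi_wedgeB w w' : levi_wedge L (w - w') = levi_wedge L w - levi_wedge L w'.
Proof.
apply/rowP => a; rewrite levi_wedgeE [RHS]mxE [X in _ = _ + X]mxE !levi_wedgeE.
by rewrite linearB /= mulmxBr linearB /= mulrBr.
Qed.

Lemma wedge_metricBl w1 w2 w :
  wedge_metric hD (w1 - w2) w = wedge_metric hD w1 w - wedge_metric hD w2 w.
Proof. by rewrite !wedge_metricE linearB /= !mulmxBl linearB /= mulrBr. Qed.

Definition levi_lift (c : 'rV[R]_m) := \sum_b c 0 b *: levi_dual b.

Lemma levi_lift_antisym c : antisym (levi_lift c).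
Proof.
rewrite /antisym /levi_lift linear_sum -sumrN; apply: eq_bigr => b _.
by rewrite linearZ /= levi_dual_antisym scalerN.
Qed.

Lemma levi_wedge_lift c : levi_wedge L (levi_lift c) = c *m K.
Proof.
apply/rowP => a; rewrite levi_wedgeE /levi_lift linear_sum mulmx_sumr linear_sum.
rewrite mulr_sumr [RHS]mxE; apply: eq_bigr => b _ /=.
rewrite linearZ -scalemxAr linearZ /= mulrCA -levi_wedgeE levi_wedge_dual.
by rewrite -[in RHS](cometric_sym hi) [in RHS]mxE.
Qed.

Lemma wedge_metric_lift c w : antisym w ->
  wedge_metric hD (levi_lift c) w = (c *m (levi_wedge L w)^T) 0 0.
Proof.
move=> wa; rewrite wedge_metricE /levi_lift linear_sum !mulmx_suml linear_sum.
rewrite mulr_sumr [RHS]mxE; apply: eq_bigr => b _ /=.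
rewrite linearZ -!scalemxAl linearZ /= mulrCA -wedge_metricE wedge_metric_dual //.
by rewrite [in RHS]mxE.
Qed.

(** Subtracting from [w] the lift of its image leaves an element of the kernel, orthogonal to [w'];
    so [w] may be replaced by the lift, on which the metric is explicit. *)
Lemma Qmetric_cometric : K \in unitmx -> Qmetric hD L (invmx K).
Proof.
move=> uK w w' [wa wo] [wa' wo'].
pose c := levi_wedge L w *m invmx K.
have z0 : levi_wedge L (w - levi_lift c) = 0.
  by rewrite levi_wedgeB levi_wedge_lift mulmxKV // subrr.
have za : antisym (w - levi_lift c) by apply: antisymB => //; exact: levi_lift_antisym.
have := wo' _ za z0; rewrite wedge_metricC wedge_metricBl => /eqP.
by rewrite subr_eq0 => /eqP ->; rewrite wedge_metric_lift.
Qed.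

Lemma Qmetric_eq hQ : K \in unitmx -> Qmetric hD L hQ -> hQ = invmx K.
Proof.
move=> uK QhQ; have KE b : levi_wedge L (levi_dual b) = row b K.
  by apply/rowP => a; rewrite levi_wedge_dual -[in LHS](cometric_sym hi) !mxE.
have : K *m hQ *m K = K.
  apply/matrixP => a b; have := QhQ _ _ (levi_dual_orth a) (levi_dual_orth b).
  rewrite wedge_metric_dual; last exact: levi_dual_antisym.
  rewrite levi_wedge_dual !KE => <-; rewrite -row_mul.
  rewrite -[X in _ = (_ *m X) _ _]/(_^T) tr_row cometric_sym.
  by rewrite !mxE; apply: eq_bigr => j _; rewrite !mxE.
move=> KhK; apply: (can_inj (mulKmx uK)); apply: (can_inj (mulmxK uK)).
by rewrite KhK mulmxV // mul1mx.
Qed.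

(** Pairing the sum with a bivector that [levi_wedge] sends to [v] gives the squared length of
    [v]. *)
Lemma levi_sum_eq0 (v : 'rV[R]_m) : levi_surjective_frame hD L ->
  \sum_a v 0 a *: levi_mx L a = 0 -> v = 0.
Proof.
move=> surj v0; have [w wa wE] := surj v.
have : (v *m (levi_wedge L w)^T) 0 0 = 0.
  have -> : (v *m (levi_wedge L w)^T) 0 0 =
      2^-1 * \tr ((\sum_a v 0 a *: levi_mx L a) *m w^T).
    rewrite mulmx_suml linear_sum mulr_sumr mxE; apply: eq_bigr => a _.
    by rewrite -scalemxAl linearZ /= mulrCA -levi_wedgeE [in LHS]mxE.
  by rewrite v0 mul0mx mxtrace0 mulr0.
by rewrite wE => vv; apply/eqP; apply: contraPT vv => /mul_tr_gt0; rewrite lt0r => /andP[/eqP].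
Qed.

End Fixed.
End FrameAlgebra.

(** * Positivity of h^ab, and the bundle map in a frame *)

Section FrameInjectivity.
Variables (R : realType).

Lemma mxtrace_mul_tr_gt0 p q (B : 'M[R]_(p, q)) : B != 0 -> 0 < \tr (B *m B^T).
Proof.
move=> B0; have trE : \tr (B *m B^T) = \sum_i (row i B *m (row i B)^T) 0 0.
  apply: eq_bigr => i _; rewrite [LHS]mxE [RHS]mxE; apply: eq_bigr => j _.
  by rewrite [X in _ = X * _]mxE ![in RHS]mxE mxE.
have ge i : 0 <= (row i B *m (row i B)^T) 0 0.
  have [->|/mul_tr_gt0/ltW//] := eqVneq (row i B) 0.
  by rewrite mul0mx mxE.
rewrite trE lt_neqAle sumr_ge0 ?andbT; last by move=> i _; exact: ge.
apply: contra B0; rewrite eq_sym psumr_eq0; last by move=> i _; exact: ge.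
move=> /allP B0; apply/eqP/row_matrixP => i; rewrite row0; apply/eqP.
have /= := B0 i (mem_index_enum i); apply: contraTT => /mul_tr_gt0.
by rewrite lt0r => /andP[].
Qed.

Variables (k m : nat) (hD : 'M[R]_k) (L : 'I_m -> 'I_k -> 'I_k -> R).
Hypotheses (hDs : hD^T = hD) (hDp : posdef_mx hD) (La : antisymmetric_levi L).

Local Notation hi := (invmx hD).
Local Notation K := (cometric hi (levi_mx L)).

(** With h^-1 = C^T C, the value at [v] is half the squared Frobenius norm of C M C^T, where M is
    the sum of the v_a L^a; surjectivity makes M nonzero. *)
Lemma cometric_posdef : levi_surjective_frame hD L -> posdef_mx K.
Proof.
move=> surj v v0; have uD := posdef_unitmx hDp.
have [C CE] : exists C : 'M[R]_k, hi = C^T *m C.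
  by apply: cholesky; [exact: invmx_sym|exact: posdef_invmx].
have uC : C \in unitmx.
  by move: uD; rewrite -unitmx_inv CE unitmx_mul => /andP[].
pose M := \sum_a v 0 a *: levi_mx L a.
have Ma : M^T = - M.
  rewrite /M linear_sum -sumrN; apply: eq_bigr => a _.
  by rewrite linearZ /= La scalerN.
pose B := C *m M *m C^T.
have BT : B^T = - B by rewrite /B !trmx_mul trmxK Ma mulNmx mulmxN mulmxA.
have -> : (v *m K *m v^T) 0 0 = 2^-1 * \tr (B *m B^T).
  rewrite BT mulmxN mxtrace_opp mulrN -mulNr.
  have -> : \tr (B *m B) = \tr (M *m hi *m M *m hi).
    by rewrite /B CE mxtrace_mulC !mulmxA mxtrace_mulC !mulmxA mxtrace_mulC !mulmxA.
  rewrite /M mulmx_suml mulmx_suml mulmx_suml linear_sum /= mulr_sumr mxE.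
  rewrite [RHS](eq_bigr (fun a => \sum_b v 0 a * K a b * v 0 b)); last first.
    move=> a _; rewrite mulmx_sumr mulmx_suml linear_sum mulr_sumr /=.
    apply: eq_bigr => b _; rewrite -scalemxAr -!scalemxAl !linearZ /= mxE.
    by rewrite mulrCA [RHS]mulrAC; ring.
  rewrite exchange_big /=; apply: eq_bigr => b _.
  by rewrite [X in X * _ = _]mxE [X in _ * X = _]mxE mulr_suml.
apply: mulr_gt0; first by rewrite invr_gt0.
apply: mxtrace_mul_tr_gt0; apply: contraNneq v0 => B0.
apply/eqP; apply: (levi_sum_eq0 surj); rewrite -/M.
have : invmx C *m B *m invmx C^T = M.
  by rewrite /B !mulmxA mulVmx // mul1mx mulmxK // unitmx_tr.
by rewrite B0 mulmx0 mul0mx.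
Qed.

Definition levi_low_mx (hQ : 'M[R]_m) a : 'M[R]_k := \sum_b hQ a b *: levi_mx L b.

Lemma levi_low_mxE hQ a i j : levi_low L hQ a i j = levi_low_mx hQ a i j.
Proof. by rewrite summxE; apply: eq_bigr => b _; rewrite !mxE. Qed.

Lemma levi_low_mx_antisym hQ a : (levi_low_mx hQ a)^T = - levi_low_mx hQ a.
Proof.
rewrite /levi_low_mx linear_sum -sumrN; apply: eq_bigr => b _.
by rewrite linearZ /= La scalerN.
Qed.

(** Bringing the index sums into the order of matrix products transposes two antisymmetric Levi
    factors, and the two signs cancel. *)
Lemma row_bundle_map hQ (f : 'M[R]_(m, k)) b :
  row b (bundle_map hD L hQ f) = 2^-1 *: \sum_a (row a f *m levi_low_mx hQ b +
    row b f *m levi_low_mx hQ a) *m hi *m levi_mx L a.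
Proof.
have anti (A : 'M[R]_k) i j : A^T = - A -> A i j = - A j i.
  by move=> /matrixP/(_ j i); rewrite !mxE.
apply/rowP => j; rewrite [LHS]mxE [LHS]mxE [RHS]mxE summxE mulr_sumr.
apply: eq_bigr => a _; rewrite [X in _ = _ * X]mxE mulr_sumr exchange_big /=.
apply: eq_bigr => k' _.
rewrite [X in _ = _ * (X * _)]mxE mulr_suml mulr_sumr; apply: eq_bigr => i _.
have -> : levi_mx L a k' j = - L a j k' by rewrite anti // mxE.
rewrite [X in _ = _ * (X * _ * _)]mxE.
have E c d : (row c f *m levi_low_mx hQ d) 0 i = - \sum_l f c l * levi_low L hQ d i l.
  rewrite mxE -sumrN; apply: eq_bigr => l _.
  by rewrite levi_low_mxE (anti _ i l (levi_low_mx_antisym hQ d)) mxE mulrN opprK.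
rewrite !E -mulr_suml -mulr_suml -mulr_sumr big_split /=; ring.
Qed.

(** The unknown [g] has an upper Q-index, that of the bundle map a lower one. With f = hQ g, the
    value of [bundle_map] is half the trace equation [r], its Q-index lowered by hQ. *)
Lemma frame_injective (T : 'I_m -> 'M[R]_k) (g : 'M[R]_(m, k)) :
  levi_surjective_frame hD L -> bundle_map_injective_frame hD L ->
  (forall c, T c = - levi_mx L c) ->
  (forall Z, levi_trace hi T (fun X => symmetrized (contraction T X *m g^T)) Z = 0) ->
  g = 0.
Proof.
move=> surj inj TE tr0; have uD := posdef_unitmx hDp.
have uK := posdef_unitmx (cometric_posdef surj).
have KE : cometric hi T = K.
  by apply/matrixP => a b; rewrite !mxE !TE !mulNmx mulmxN mulNmx opprK.
pose hQ := invmx K.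
have hQs : hQ^T = hQ by rewrite trmx_inv cometric_sym.
have hQC a c : hQ a c = hQ c a by rewrite -[in LHS]hQs mxE.
have phiE c : raised_levi hi T c = - (hi *m levi_low_mx hQ c *m hi).
  rewrite /raised_levi /levi_low_mx mulmx_sumr mulmx_suml -sumrN.
  apply: eq_bigr => a _; rewrite KE -[invmx K]hQs mxE TE.
  by rewrite mulmxN mulNmx scalerN -scalemxAr -scalemxAl.
have phiT c : (raised_levi hi T c)^T = hi *m levi_low_mx hQ c *m hi.
  rewrite phiE linearN /= !trmx_mul invmx_sym // levi_low_mx_antisym mulNmx mulmxN.
  by rewrite opprK mulmxA.
pose r d := \sum_c (row d g *m levi_mx L c + row c g *m levi_mx L d) *m hi *m
  levi_low_mx hQ c.
have r0 d : r d = 0.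
  have his : hi^T = hi by exact: invmx_sym.
  suff : r d *m hi = 0 by move=> /(congr1 (mulmx^~ hD)); rewrite mulmxKV // mul0mx.
  apply/rowP => i; rewrite [RHS]mxE.
  have /rowP/(_ d) := tr0 (delta_mx 0 i); rewrite [RHS]mxE => <-.
  rewrite /r mulmx_suml summxE [RHS]mxE; apply: eq_bigr => c _.
  set X := delta_mx 0 i *m _.
  have -> : symmetrized (contraction T X *m g^T) c d =
      ((row d g *m levi_mx L c + row c g *m levi_mx L d) *m X^T) 0 0.
    have S a b : (contraction T X *m g^T) a b = (row b g *m levi_mx L a *m X^T) 0 0.
      have -> : (contraction T X *m g^T) a b = (X *m T a *m (row b g)^T) 0 0.
        rewrite [LHS]mxE [RHS]mxE; apply: eq_bigr => j _.
        by congr (_ * _); [rewrite [LHS]mxE|rewrite !mxE].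
      transitivity ((X *m T a *m (row b g)^T)^T 0 0); first by rewrite [RHS]mxE.
      by rewrite !trmx_mul trmxK TE linearN /= La opprK mulmxA.
    by rewrite [LHS]mxE [X in _ + X]mxE !S mulmxDl [RHS]mxE.
  by rewrite /X trmx_mul phiT !mulmxA trmx_delta -colE [RHS]mxE.
have g0 : hQ *m g = 0.
  apply: (inj hQ); first exact: Qmetric_cometric.
  apply/row_matrixP => b; rewrite !row_bundle_map; congr (_ *: _).
  transitivity (\sum_d hQ b d *: r d); last first.
    rewrite big1 => [|d _]; last by rewrite r0 scaler0.
    rewrite big1 // => a _; rewrite !(linear0 (row _)) !mul0mx addr0.
    by rewrite !mul0mx.
  have rowh c : row c (hQ *m g) = \sum_d hQ c d *: row d g.
    by rewrite row_mul mulmx_sum_row; apply: eq_bigr => d _; rewrite mxE.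
  have swap : \sum_a levi_low_mx hQ a *m hi *m levi_mx L a =
      \sum_c levi_mx L c *m hi *m levi_low_mx hQ c.
    rewrite /levi_low_mx (eq_bigr (fun a =>
      \sum_c hQ a c *: (levi_mx L c *m hi *m levi_mx L a))); last first.
      by move=> a _; rewrite !mulmx_suml; apply: eq_bigr => c _; rewrite -!scalemxAl.
    rewrite exchange_big /=; apply: eq_bigr => c _; rewrite mulmx_sumr.
    by apply: eq_bigr => a _; rewrite -scalemxAr (hQC a c).
  have E1 : \sum_a row a (hQ *m g) *m levi_low_mx hQ b *m hi *m levi_mx L a =
      \sum_c row c g *m levi_low_mx hQ b *m hi *m levi_low_mx hQ c.
    rewrite (eq_bigr (fun a =>
      \sum_c hQ a c *: (row c g *m levi_low_mx hQ b *m hi *m levi_mx L a))); last first.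
      by move=> a _; rewrite rowh !mulmx_suml; apply: eq_bigr => c _; rewrite -!scalemxAl.
    rewrite exchange_big /=; apply: eq_bigr => c _.
    rewrite [X in _ = _ *m X]/levi_low_mx [RHS]mulmx_sumr.
    by apply: eq_bigr => a _; rewrite -scalemxAr (hQC a c).
  have E2 : \sum_a row b (hQ *m g) *m levi_low_mx hQ a *m hi *m levi_mx L a =
      row b (hQ *m g) *m \sum_c levi_mx L c *m hi *m levi_low_mx hQ c.
    by rewrite -swap mulmx_sumr; apply: eq_bigr => a _; rewrite !mulmxA.
  under eq_bigr => a _ do rewrite mulmxDl mulmxDl.
  rewrite big_split /= E1 E2 rowh mulmx_suml.
  rewrite (eq_bigr (fun c =>
    \sum_d hQ b d *: (row c g *m levi_mx L d *m hi *m levi_low_mx hQ c))); last first.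
    move=> c _; have -> : row c g *m levi_low_mx hQ b = \sum_d hQ b d *: (row c g *m levi_mx L d).
      by rewrite mulmx_sumr; apply: eq_bigr => d _; rewrite -scalemxAr.
    by rewrite !mulmx_suml; apply: eq_bigr => d _; rewrite -!scalemxAl.
  rewrite exchange_big /= -big_split /=; apply: eq_bigr => d _ /=.
  rewrite -scaler_sumr -scalemxAl -scalerDr; congr (_ *: _).
  rewrite /r mulmx_sumr -big_split; apply: eq_bigr => c _ /=.
  by rewrite addrC !mulmxDl !mulmxA.
have uQ : hQ \in unitmx by rewrite unitmx_inv.
by rewrite -[g](mulKmx uQ) g0 mulmx0.
Qed.

End FrameInjectivity.

(** * From the hypotheses in frames to coframes *)

Section Regularity.
Variables (R : realType) (n : nat).
Implicit Types (H : 'rV[R]_n -> 'M[R]_n) (V W : set 'rV[R]_n).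

Lemma cometric_opp k m (S : 'M[R]_k) (T : 'I_m -> 'M[R]_k) :
  cometric S (fun c => - T c) = cometric S T.
Proof. by apply/matrixP => a b; rewrite !mxE !mulNmx mulmxN mulNmx opprK. Qed.

Lemma row_mul_tr k l p (A : 'M[R]_(k, p)) (B : 'M[R]_(l, p)) i j :
  (row i A *m (row j B)^T) 0 0 = (A *m B^T) i j.
Proof. by rewrite !mxE; apply: eq_bigr => q _; rewrite !mxE. Qed.

Lemma gram_mulmx k (A : 'M[R]_(k, n)) (S : 'M[R]_n) : S^T = S ->
  gram S (A *m S) = A *m S *m A^T.
Proof.
move=> Ss; apply/matrixP => i j; rewrite [LHS]mxE /hmetric.
have -> : (row j (A *m S))^T = S *m (row j A)^T by rewrite row_mul trmx_mul Ss.
rewrite mulmxA mulmxKpV; last exact: submx_trans (row_sub _ _) (submxMl _ _).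
exact: row_mul_tr.
Qed.

Lemma sandwich_antisym k (P : 'M[R]_(k, n)) (Q : 'M[R]_n) : Q^T = - Q ->
  (P *m Q *m P^T)^T = - (P *m Q *m P^T).
Proof. by move=> Qa; rewrite !trmx_mul trmxK Qa mulNmx mulmxN !mulmxA. Qed.

(** The expansion h = h^ij e_i e_j in the frame formed by the rows of [A *m S], whose Gram matrix is
    [hD]. *)
Lemma frame_decomposition k (A : 'M[R]_(k, n)) (S : 'M[R]_n) : S^T = S ->
  row_free (A *m S) -> (S <= A *m S)%MS ->
  let hD := A *m S *m A^T in hD \in unitmx /\ S = (A *m S)^T *m invmx hD *m (A *m S).
Proof.
move=> Ss free /submxP[B SB] hD.
have hDs : hD^T = hD by rewrite /hD !trmx_mul trmxK Ss mulmxA.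
have E : A *m S = hD *m B^T.
  have EB : (A *m S)^T = B *m hD by rewrite trmx_mul Ss {1}SB -mulmxA.
  by rewrite -[LHS]trmxK EB trmx_mul hDs.
have uD : hD \in unitmx.
  rewrite -row_free_unit /row_free eqn_leq rank_leq_row /=.
  by rewrite -[X in (X <= _)%N](eqP free) E mxrankM_maxl.
split=> //; rewrite E trmx_mul trmxK hDs mulmxK // -E.
by rewrite [LHS]SB.
Qed.

Lemma contraction_mul_tr m (th : 'rV[R]_n -> 'M[R]_(n, m)) x (X Y : 'rV[R]_n) c :
  differentiable th x ->
  (X *m dform th x c *m Y^T) 0 0 =
    (Y *m 'D_X th x) 0 c - (X *m 'D_Y th x) 0 c.
Proof.
move=> dth.
have -> : X *m dform th x c = row c (contraction (dform th x) X) by rewrite rowK.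
rewrite contraction_dform // (derive_sum_coord Y dth) mulmx_sumr summxE.
rewrite [LHS]mxE [X in _ = X - _]mxE -sumrB; apply: eq_bigr => q _.
rewrite [X in X * _]mxE [X in X * _]mxE [X in (X + _) * _]mxE [X in (_ + X) * _]mxE.
by rewrite [X in (_ - X) * _]mxE [X in _ * X = _]mxE -scalemxAr [X in _ = _ - X]mxE; ring.
Qed.

Lemma dform_antisym m (th : 'rV[R]_n -> 'M[R]_(n, m)) x c :
  (dform th x c)^T = - dform th x c.
Proof. by apply/matrixP => i j; rewrite [LHS]mxE [LHS]mxE [RHS]mxE [X in _ = - X]mxE opprB. Qed.

(** Cartan's formula on D: since theta(X) and theta(Y) vanish identically, differentiating these
    identities moves the derivatives from the fields to theta. *)
Lemma lie_bracket_coframe H V m (th : 'rV[R]_n -> 'M[R]_(n, m)) x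
    (X Y : 'rV[R]_n -> 'rV[R]_n) c : open_nbhs x V -> smooth_on V th ->
  smooth_on V X -> smooth_on V Y ->
  (forall y, V y -> X y *m th y = 0) -> (forall y, V y -> Y y *m th y = 0) ->
  (lie_bracket X Y x *m th x) 0 c = - (X x *m dform th x c *m (Y x)^T) 0 0.
Proof.
move=> [oV Vx] sth sX sY Xth Yth.
have dth := smooth_differentiable sth Vx.
have D (Z : 'rV[R]_n -> 'rV[R]_n) v : smooth_on V Z -> (forall y, V y -> Z y *m th y = 0) ->
    'D_v Z x *m th x = - (Z x *m 'D_v th x).
  move=> sZ Zth; have dZ := smooth_differentiable sZ Vx.
  apply/eqP; rewrite -addr_eq0; apply/eqP.
  apply: etrans (esym (derive_mulmx v dZ dth)) _.
  apply: etrans (derive_cst (0 : 'M[R]_(1, m)) x v).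
  apply: near_eq_derive; near=> y; apply: Zth; near: y.
  exact: open_nbhs_nbhs.
rewrite contraction_mul_tr // /lie_bracket mulmxBl !D // opprK addrC.
by rewrite [LHS]mxE [X in _ + X = _]mxE opprB.
Unshelve. all: by end_near. Qed.

(** Given a coframe, take a frame of D together with vectors [U] dual to the coframe at [x].
    Components modulo D are then values of the coframe, so the Levi components are those of - d
    theta on the frame, and the frame acts as a rectangular Jacobian between the two
    descriptions. *)
Lemma regular_at_frames H V x : open_nbhs x V -> smooth_on V H ->
  (forall y, V y -> (H y)^T = H y) ->
  (forall y, V y -> \rank (H y) = \rank (H x)) ->
  (forall u : 'rV[R]_n, u *m H x != 0 -> 0 < (u *m H x *m u^T) 0 0) ->
  (forall k m (E : 'rV[R]_n -> 'M[R]_(k, n)) (U : 'M[R]_(m, n)) L,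
    adapted_frame H x E U -> levi_components H x E U L ->
    levi_surjective_frame (gram (H x) (E x)) L /\
    bundle_map_injective_frame (gram (H x) (E x)) L) ->
  regular_at H x.
Proof.
move=> oV sH Hs rH Hpos hyp m th V1 oV1 cth1.
pose r := \rank (H x).
have [A [B AHB]] := exists_unit_minor (H x).
pose V2 := V `&` V1.
have [oV' Vx] := oV; have [oV1' V1x] := oV1.
have oV2 : open_nbhs x V2 by split=> //; exact: openI.
have V2V : V2 `<=` V by move=> y [].
have cth : coframe_on H V2 th by apply: coframe_onS cth1 => y [].
have [E EE] : exists E, forall y, E y = A *m H y by exists (fun y => A *m H y).
have sE : smooth_on V2 E.
  have [oo _] := oV2; move=> k; have -> : E = fun y => A *m H y by exact/funext.
  apply: (Ck_on_mulmx (f := fun=> A)) => //; first exact: Ck_on_cst.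
  exact: smooth_onS V2V sH k.
have sEB : smooth_on V2 (fun y => E y *m B).
  have [oo _] := oV2; move=> k; apply: (Ck_on_mulmx (g := fun=> B)) (sE k) _ => //.
  exact: Ck_on_cst.
have [|W [oW WV2 uW]] := near_unitmx oV2 sEB; first by rewrite EE AHB unitmx1.
have [oW' Wx] := oW.
have cW : coframe_on H W th by exact: coframe_onS cth.
have Hsx : (H x)^T = H x by exact: Hs.
have frE y : W y -> row_free (E y) /\ (H y <= E y)%MS.
  move=> Wy; have Vy := V2V _ (WV2 _ Wy).
  have rE : \rank (E y) = r.
    apply/eqP; rewrite eqn_leq rank_leq_row /=.
    by rewrite -[X in (X <= _)%N](mxrank_unit (uW _ Wy)) mxrankM_maxl.
  split; first by rewrite /row_free rE.
  have sEH : (E y <= H y)%MS by rewrite EE; exact: submxMl.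
  by have [_ <-] := mxrank_leqif_sup sEH; rewrite rE rH.
have Eth y : W y -> E y *m th y = 0.
  by move=> Wy; have [Hth _ _] := cW.2 _ Wy; rewrite EE -mulmxA Hth mulmx0.
have [U Uth] := coframe_left_inverse Wx cW.
pose T c := E x *m dform th x c *m (E x)^T.
pose L a i j := - T a i j.
have TL c : T c = - levi_mx L c by apply/matrixP => i j; rewrite [RHS]mxE [X in _ = - X]mxE opprK.
have La : antisymmetric_levi L.
  move=> a; have TT : (T a)^T = - T a.
    exact/sandwich_antisym/dform_antisym.
  by rewrite -[levi_mx L a]opprK -TL linearN /= TT.
have adF : adapted_frame H x E U.
  have rmn : (r + m = n)%N by have [] := cW.2 _ Wx.
  split=> //.
    exists W; split=> //; first exact: smooth_onS WV2 sE.
    move=> y Wy; have [fE HE] := frE _ Wy; split=> //.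
    by rewrite HE andbT EE submxMl.
  rewrite -kermx_eq0; apply/rowV0P => w /sub_kermxP.
  rewrite -[w]hsubmxK mul_row_col => w0.
  have w2 : rsubmx w = 0.
    have := congr1 (mulmx^~ (th x)) w0.
    by rewrite mulmxDl -!mulmxA Uth Eth // mulmx0 add0r mulmx1 mul0mx.
  move: w0; rewrite w2 mul0mx addr0 => w1.
  have [fE _] := frE _ Wx.
  have -> : lsubmx w = 0 by apply: (row_free_inj fE); rewrite w1 mul0mx.
  by rewrite row_mx0.
have sEW : smooth_on W E by exact: smooth_onS sE.
have srow i : smooth_on W (fun y => row i (E y)).
  move=> k; apply: Ck_on_mx => // a j.
  have := Ck_on_coord i j oW' (sEW k).
  by apply: Ck_on_eq => // y _; rewrite mxE.
have lc : levi_components H x E U L.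
  move=> i j; rewrite (coframe_sub _ Hsx Wx cW) mulmxBl mulmx_suml subr_eq0.
  apply/eqP/rowP => c.
  have := @lie_bracket_coframe H W m th x (fun y => row i (E y)) (fun y => row j (E y)) c
    oW cW.1 (srow i) (srow j).
  rewrite -row_mul row_mul_tr => ->.
  - rewrite summxE (bigD1 c) //= big1 ?addr0 => [|a ac].
      by rewrite -scalemxAl -row_mul Uth [RHS]mxE [X in _ * X]mxE [X in _ * X]mxE eqxx mulr1.
    by rewrite -scalemxAl -row_mul Uth [LHS]mxE [X in _ * X]mxE [X in _ * X]mxE (negbTE ac) mulr0.
  - by move=> y Wy; rewrite -row_mul Eth // row0.
  - by move=> y Wy; rewrite -row_mul Eth // row0.
have [surj inj] := hyp _ _ _ _ _ adF lc.
have gE : gram (H x) (E x) = E x *m A^T by rewrite EE; exact: gram_mulmx.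
have [fEx HEx] := frE _ Wx.
have [] := @frame_decomposition _ A (H x) Hsx; rewrite -?EE // => uD HE.
rewrite gE in surj inj; set hD := E x *m A^T in surj inj uD HE.
have hDs : hD^T = hD by rewrite /hD EE !trmx_mul trmxK Hsx mulmxA.
have hDp : posdef_mx hD.
  move=> w w0; have := Hpos (w *m A); rewrite trmx_mul /hD EE !mulmxA; apply.
  apply: contra w0 => /eqP wE; apply/eqP; apply: (row_free_inj fEx).
  by rewrite mul0mx EE mulmxA.
have KE : cometric_field H th x = cometric (invmx hD) (levi_mx L).
  rewrite -cometric_opp; apply: esym; apply: (cometric_pullback (J := E x)) => // c.
  by rewrite -TL.
split; first by rewrite KE; exact: cometric_posdef.
move=> phi phith tr0.
have : (phi <= E x)%MS.
  apply: submx_trans HEx; apply/row_subP => i; rewrite (coframe_sub _ Hsx Wx cW).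
  by rewrite -row_mul phith row0.
move=> /submxP[g phiE]; rewrite phiE.
suff -> : g = 0 by rewrite mul0mx.
apply: (frame_injective hDs hDp La surj inj TL) => Z.
rewrite (levi_trace_pullback (H' := H x) (J := E x) (J' := pinvmx (E x)) (T' := dform th x)
  (N' := fun X => symmetrized (contraction (dform th x) X *m phi^T))) //.
- by rewrite mulmxVp.
- move=> X; congr symmetrized; apply/row_matrixP => c.
  by rewrite !row_mul !rowK phiE trmx_mul !mulmxA.
Qed.

End Regularity.

(** * Contact and free distributions *)

Section ContactFree.
Variables (R : realType).

Lemma bundle_mapB k m (hD : 'M[R]_k) L (hQ : 'M[R]_m) (f f' : 'M[R]_(m, k)) :
  bundle_map hD L hQ (f - f') = bundle_map hD L hQ f - bundle_map hD L hQ f'.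
Proof.
apply/matrixP => b j; have E g : bundle_map hD L hQ g b j =
    \sum_a \sum_i \sum_k' \sum_l 2^-1 * (g a l * levi_low L hQ b i l +
      g b l * levi_low L hQ a i l) * L a j k' * (invmx hD) i k' by rewrite mxE.
rewrite [RHS]mxE [X in _ = _ + X]mxE !E.
do 4 (rewrite -sumrB; apply: eq_bigr => ? _).
by rewrite !mxE; ring.
Qed.

Lemma bundle_map_inj_ker k m (hD : 'M[R]_k) L (hQ : 'M[R]_m) :
  (forall f, bundle_map hD L hQ f = 0 -> f = 0) -> injective (bundle_map hD L hQ).
Proof.
move=> ker0 f f' ff'; apply/eqP; rewrite -subr_eq0; apply/eqP/ker0.
by rewrite bundle_mapB ff' subrr.
Qed.

Lemma contact_frame_nondegenerate k (hD : 'M[R]_k) (L : 'I_1 -> 'I_k -> 'I_k -> R) :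
  contact_frame hD L -> levi_mx L 0 \in unitmx.
Proof.
move=> [_ nd]; rewrite -row_free_unit -kermx_eq0; apply/rowV0P => X /sub_kermxP XM.
apply: nd => a Y; rewrite (ord1 a).
have -> : \sum_i \sum_j L 0 i j * X 0 i * Y 0 j = (X *m levi_mx L 0 *m Y^T) 0 0.
  rewrite exchange_big mxE; apply: eq_bigr => j _ /=.
  rewrite [X in X * _]mxE mulr_suml; apply: eq_bigr => i _.
  by rewrite !mxE; ring.
by rewrite XM mul0mx mxE.
Qed.

(** With a single Q-index the two terms of the bundle map coincide, and it becomes right
    multiplication by a product of invertible matrices. *)
Lemma contact_frame_regular k (hD : 'M[R]_k) (L : 'I_1 -> 'I_k -> 'I_k -> R) :
  (0 < k)%N -> hD^T = hD -> posdef_mx hD -> antisymmetric_levi L ->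
  contact_frame hD L ->
  levi_surjective_frame hD L /\ bundle_map_injective_frame hD L.
Proof.
move=> k0 hDs hDp La /contact_frame_nondegenerate uM.
have M0 : levi_mx L 0 != 0.
  apply/eqP => M0; have := mxrank_unit uM; rewrite M0 mxrank0 => kE.
  by move: k0; rewrite -kE.
have surj : levi_surjective_frame hD L.
  (* The image under [levi_wedge] of the Levi matrix itself, nonzero because L is; multiples of that
     matrix reach every [v]. *)
  move=> v; pose t := 2^-1 * \tr (levi_mx L 0 *m (levi_mx L 0)^T).
  have t0 : t != 0 by rewrite gt_eqF // mulr_gt0 ?invr_gt0 // mxtrace_mul_tr_gt0.
  exists ((v 0 0 / t) *: levi_mx L 0).
    by rewrite /antisym linearZ /= La scalerN.
  apply/rowP => a; rewrite (ord1 a) levi_wedgeE linearZ /= -scalemxAr linearZ /=.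
  by rewrite mulrCA -/t divfK.
split=> // hQ QhQ; apply: bundle_map_inj_ker => f bf0.
have uD := posdef_unitmx hDp.
have uK := posdef_unitmx (cometric_posdef hDs hDp La surj).
have hQE := Qmetric_eq hDs uD La uK QhQ.
have uQ : hQ \in unitmx by rewrite hQE unitmx_inv.
have q0 : hQ 0 0 != 0 by move: uQ; rewrite unitmxE det_mx11 unitfE.
have := row_bundle_map hD La hQ f 0.
rewrite bf0 linear0 big_ord1 /levi_low_mx big_ord1 => /esym/eqP.
rewrite scaler_eq0 invr_eq0 pnatr_eq0 /= => /eqP fM.
have {}fM : row 0 f *m (hQ 0 0 *: levi_mx L 0) = 0.
  have /(congr1 (mulmx^~ hD)) : (row 0 f *m (hQ 0 0 *: levi_mx L 0) +
      row 0 f *m (hQ 0 0 *: levi_mx L 0)) *m invmx hD = 0.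
    by rewrite -[LHS](mulmxK uM) fM mul0mx.
  rewrite mulmxKV // mul0mx -mulr2n => /eqP.
  by rewrite -scaler_nat scaler_eq0 pnatr_eq0 => /eqP.
have uqM : hQ 0 0 *: levi_mx L 0 \in unitmx by rewrite unitmxZ ?unitfE.
apply/row_matrixP => i; rewrite (ord1 i) row0.
by rewrite -[LHS](mulmxK uqM) fM mul0mx.
Qed.

Section Free.
Variables (k m : nat) (hD : 'M[R]_k) (L : 'I_m -> 'I_k -> 'I_k -> R).
Hypotheses (hDs : hD^T = hD) (hDp : posdef_mx hD) (La : antisymmetric_levi L).
Hypothesis free : free_frame hD L.

Local Notation hi := (invmx hD).

Lemma free_frame_surjective : levi_surjective_frame hD L.
Proof. by move=> v; have [w [[wa wE] _]] := free v; exists w. Qed.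

Lemma free_frame_ker_orth w : antisym w -> levi_ker_orth hD L w.
Proof.
move=> wa; split=> // z za z0; have [w0 [_ uniq]] := free 0.
have a0 : antisym (0 : 'M[R]_k) by rewrite /antisym trmx0 oppr0.
have -> : z = 0.
  rewrite -(uniq z (conj za z0)); apply: uniq; split=> //.
  by apply/rowP => a; rewrite levi_wedgeE trmx0 mulmx0 mxtrace0 mulr0 mxE.
by rewrite wedge_metricE mulmx0 mul0mx mxtrace0 mulr0.
Qed.

Lemma mxtrace_delta (P Q : 'M[R]_k) a b c d :
  \tr (delta_mx a b *m P *m delta_mx c d *m Q) = P b c * Q d a.
Proof.
have -> : delta_mx a b *m P *m delta_mx c d *m Q =
    delta_mx a (0 : 'I_1) *m row b (col c P *m row d Q).
  rewrite row_mul rowE colE rowE -[delta_mx a b](mul_delta_mx (0 : 'I_1)).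
  by rewrite -[delta_mx c d](mul_delta_mx (0 : 'I_1)) !mulmxA.
rewrite mxtrace_mulC -colE /mxtrace big_ord1 !mxE big_ord1 !mxE.
by [].
Qed.

Definition bivector i l : 'M[R]_k := delta_mx i l - delta_mx l i.

Lemma bivector_antisym i l : antisym (bivector i l).
Proof. by rewrite /antisym /bivector linearB /= !trmx_delta opprB. Qed.

Lemma levi_wedge_bivector i l a : levi_wedge L (bivector i l) 0 a = L a i l.
Proof.
have LE p q : \tr (levi_mx L a *m delta_mx p q) = L a q p.
  transitivity (\tr (delta_mx q q *m levi_mx L a *m delta_mx p q *m 1%:M)).
    by rewrite mulmx1 -mulmxA [RHS]mxtrace_mulC -mulmxA mul_delta_mx.
  by rewrite mxtrace_delta [X in _ * X]mxE eqxx mulr1 [LHS]mxE.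
have Laa : L a l i = - L a i l by have /matrixP/(_ i l) := La a; rewrite !mxE.
rewrite levi_wedgeE bivector_antisym opprB mulmxBr linearB /= !LE Laa opprK.
by field.
Qed.

(** The kernel being zero, Q carries the metric of the whole exterior square, and L_bil L^b_rs is
    the inner product of e_i /\ e_l with e_r /\ e_s. *)
Lemma levi_low_free (hQ : 'M[R]_m) i l r s : hQ^T = hQ -> Qmetric hD L hQ ->
  \sum_b levi_low_mx L hQ b i l * L b r s = hD i r * hD l s - hD i s * hD l r.
Proof.
move=> hQs QhQ.
have hDC a b : hD a b = hD b a by rewrite -[in LHS]hDs mxE.
have := QhQ _ _ (free_frame_ker_orth (bivector_antisym i l))
  (free_frame_ker_orth (bivector_antisym r s)).
have bivectorN : - bivector i l = bivector l i by rewrite /bivector opprB.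
rewrite wedge_metricE bivector_antisym hDs bivectorN {bivectorN}.
have -> : \tr (bivector l i *m hD *m bivector r s *m hD) = hD i r * hD s l - hD l r * hD s i -
    (hD i s * hD r l - hD l s * hD r i).
  by rewrite /bivector mulmxBr !mulmxBl !(raddfB (mxtrace (n := k))) /= !mxtrace_delta.
move=> E.
have -> : hD i r * hD l s - hD i s * hD l r = 2^-1 *
   (hD i r * hD s l - hD l r * hD s i - (hD i s * hD r l - hD l s * hD r i)).
  by rewrite (hDC s l) (hDC s i) (hDC r l) (hDC r i); field.
rewrite -E [RHS]mxE; apply: eq_bigr => b _.
rewrite [X in _ = _ * X]mxE levi_wedge_bivector; congr (_ * _).
rewrite summxE [RHS]mxE; apply: eq_bigr => a _.
by rewrite levi_wedge_bivector mxE -[in LHS]hQs mxE [X in _ * X]mxE mulrC.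
Qed.

(* With [G r s j] the components f_(rs),j obtained from the identification of Q
   with the second exterior power of D, an element of the kernel satisfies
   (k - 1) f_(rs),j = f_(sj),r + f_(jr),s, so that k f_(rs),j is the cyclic sum C;
   summing cyclically gives k C = 3 C. *)
Lemma free_frame_injective : k <> 3%N -> bundle_map_injective_frame hD L.
Proof.
move=> k3 hQ QhQ; have surj := free_frame_surjective.
have uD := posdef_unitmx hDp.
have uK := posdef_unitmx (cometric_posdef hDs hDp La surj).
have hQE := Qmetric_eq hDs uD La uK QhQ.
have hQs : hQ^T = hQ by rewrite hQE trmx_inv cometric_sym.
have I := levi_low_free _ _ _ _ hQs QhQ.
apply: bundle_map_inj_ker => f bf0.
pose g := f *m hD; pose G r s j := \sum_a g a j * L a r s.
have hDC a b : hD a b = hD b a by rewrite -[in LHS]hDs mxE.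
(* Contracting [I] with the inverse metric: one term gives [hD], the other the trace k. *)
have SE : \sum_a levi_low_mx L hQ a *m hi *m levi_mx L a = (1 - k%:R) *: hD.
  apply/matrixP => x j; rewrite summxE.
  transitivity (\sum_y \sum_l hi l y * (hD x y * hD l j - hD x j * hD l y)).
    rewrite (eq_bigr (fun a => \sum_y \sum_l
        hi l y * (levi_low_mx L hQ a x l * L a y j))); last first.
      move=> a _; rewrite mxE; apply: eq_bigr => y _.
      rewrite [X in X * _]mxE [X in _ * X]mxE mulr_suml; apply: eq_bigr => l _.
      by rewrite mulrAC mulrC.
    rewrite exchange_big /=; apply: eq_bigr => y _.
    rewrite exchange_big /=; apply: eq_bigr => l _.
    by rewrite -mulr_sumr I.
  have E1 : \sum_y \sum_l hD x y * hi l y * hD l j = hD x j.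
    transitivity ((hD *m hi *m hD) x j); last by rewrite mulmxV // mul1mx.
    rewrite exchange_big [RHS]mxE /=; apply: eq_bigr => l _.
    rewrite -mulr_suml; congr (_ * _); rewrite [RHS]mxE; apply: eq_bigr => y _.
    by rewrite -[hi in RHS](invmx_sym hDs) [in RHS]mxE.
  have E2 : \sum_y \sum_l hi l y * hD l y = k%:R.
    transitivity (\tr (hD *m hi)); last by rewrite mulmxV // mxtrace1.
    rewrite /mxtrace; apply: eq_bigr => y _; rewrite [RHS]mxE; apply: eq_bigr => l _.
    by rewrite mulrC (hDC l y).
  transitivity (\sum_y \sum_l hD x y * hi l y * hD l j -
    (\sum_y \sum_l hi l y * hD l y) * hD x j).
    rewrite mulr_suml -sumrB; apply: eq_bigr => y _.
    by rewrite mulr_suml -sumrB; apply: eq_bigr => l _; ring.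
  by rewrite E1 E2 [RHS]mxE mulrBl mul1r.
(* The kernel equation, contracted in its Q-index with L^b_rs; [I] evaluates the first term and [SE]
   the second. *)
have EQ r s j : G s j r - G r j s + (1 - k%:R) * G r s j = 0.
  have R0 b : \sum_a row a f *m levi_low_mx L hQ b *m hi *m levi_mx L a +
      row b f *m ((1 - k%:R) *: hD) = 0.
    have RB : \sum_a (row a f *m levi_low_mx L hQ b + row b f *m levi_low_mx L hQ a) *m
        hi *m levi_mx L a = 0.
      have := row_bundle_map hD La hQ f b; rewrite bf0 linear0 => /esym/eqP.
      by rewrite scaler_eq0 invr_eq0 pnatr_eq0 /= => /eqP.
    rewrite -[RHS]RB -SE; apply: etrans (congr1 (GRing.add _) (mulmx_sumr _ _ _ _)) _.
    rewrite -big_split; apply: eq_bigr => a _ /=.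
    by rewrite !mulmxDl !mulmxA.
  have : \sum_b L b r s *: (\sum_a row a f *m levi_low_mx L hQ b *m hi *m levi_mx L a +
      row b f *m ((1 - k%:R) *: hD)) = 0.
    by rewrite big1 // => b _; rewrite R0 scaler0.
  under eq_bigr => b _ do rewrite scalerDr scaler_sumr.
  rewrite big_split exchange_big /=.
  have T1 a : \sum_b L b r s *: (row a f *m levi_low_mx L hQ b *m hi *m levi_mx L a) =
      g a r *: row s (levi_mx L a) - g a s *: row r (levi_mx L a).
    have F : \sum_b L b r s *: (row a f *m levi_low_mx L hQ b) =
        g a r *: row s hD - g a s *: row r hD.
      apply/rowP => i; rewrite summxE.
      transitivity (\sum_l f a l * (hD l r * hD i s - hD l s * hD i r)).
        rewrite (eq_bigr (fun b => \sum_l f a l * (levi_low_mx L hQ b l i * L b r s))).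
          by rewrite exchange_big /=; apply: eq_bigr => l _; rewrite -mulr_sumr I.
        move=> b _; rewrite mxE [X in _ * X]mxE mulr_sumr; apply: eq_bigr => l _.
        by rewrite [X in _ * (X * _)]mxE; ring.
      have gE b : g a b = \sum_l f a l * hD l b by rewrite mxE.
      rewrite [RHS]mxE [X in X + _]mxE [X in _ * X + _]mxE [X in _ = _ + X]mxE.
      rewrite [X in _ - X]mxE [X in _ - _ * X]mxE !gE !mulr_suml -sumrB.
      by apply: eq_bigr => l _; rewrite (hDC s i) (hDC r i); ring.
    have /(congr1 (mulmx^~ (hi *m levi_mx L a))) := F.
    rewrite mulmxBl -!scalemxAl -!row_mul mulKVmx // => <-.
    rewrite mulmx_suml; apply: eq_bigr => b _.
    by rewrite -scalemxAl !mulmxA.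
  under eq_bigr => a _ do rewrite T1.
  move=> /rowP/(_ j); rewrite [RHS]mxE [LHS]mxE !summxE => E0.
  apply: etrans _ E0; congr (_ + _).
    rewrite /G -sumrB; apply: eq_bigr => a _.
    rewrite [RHS]mxE [X in _ = X + _]mxE [X in _ = _ + X]mxE [X in _ = _ - X]mxE.
    by congr (_ * _ - _ * _); rewrite !mxE.
  rewrite /G mulr_sumr; apply: eq_bigr => b _.
  by rewrite [RHS]mxE -scalemxAr -row_mul [X in _ = _ * X]mxE [X in _ = _ * (_ * X)]mxE; ring.
have Ga r s j : G r s j = - G s r j.
  rewrite /G -sumrN; apply: eq_bigr => a _.
  by have /matrixP/(_ r s) := La a; rewrite !mxE => ->; rewrite mulrN opprK.
(* The existence of an index in ['I_k] excludes k = 0. *)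
have k0 (i : 'I_k) : k%:R != 0 :> R by rewrite pnatr_eq0; case: k i => [[]|].
have k30 : k%:R - 3 != 0 :> R.
  by rewrite subr_eq0 (eqr_nat _ k 3); apply/eqP.
have G0 r s j : G r s j = 0.
  have e1 := EQ r s j; have e2 := EQ s j r; have e3 := EQ j r s.
  have a1 := Ga r j s; have a2 := Ga s r j; have a3 := Ga j s r.
  pose C := G r s j + G s j r + G j r s.
  have cyc (x y z : R) : y - (- z) + (1 - k%:R) * x = 0 -> k%:R * x = x + y + z.
    move=> E; have -> : k%:R * x = x + y + z - (y - (- z) + (1 - k%:R) * x) by ring.
    by rewrite E subr0.
  have c1 : k%:R * G r s j = C by apply: cyc; rewrite -a1.
  have c2 : k%:R * G s j r = C by rewrite /C -addrA addrC; apply: cyc; rewrite -a2.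
  have c3 : k%:R * G j r s = C.
    by rewrite /C addrC addrA; apply: cyc; rewrite -a3.
  have : (k%:R - 3) * C = 0.
    have kC : k%:R * C = C + C + C by rewrite {1}/C !mulrDr c1 c2 c3.
    by rewrite mulrBl kC; move: (C) => D; ring.
  move=> /eqP; rewrite mulf_eq0 (negbTE k30) /= => /eqP C0.
  by apply: (mulfI (k0 r)); rewrite c1 C0 mulr0.
have g0 : g = 0.
  apply/matrixP => a j; rewrite [RHS]mxE.
  have : (col j g)^T = 0.
    apply: (levi_sum_eq0 surj); apply/matrixP => r s; rewrite summxE [RHS]mxE.
    apply: etrans _ (G0 r s j).
    by apply: eq_bigr => c _; rewrite !mxE.
  by move=> /rowP/(_ a); rewrite !mxE.
by rewrite -[f](mulmxK uD) -/g g0 mul0mx.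
Qed.

End Free.
End ContactFree.

(** * The canonical metric of a sub-Riemannian manifold *)

Section Assembly.
Variables (R : realType).

Lemma Ck_on_local (U W : normedModType R) k (V : set U) (f : U -> W) :
  (forall x, V x -> exists2 V', open_nbhs x V' & Ck_on k V' f) -> Ck_on k V f.
Proof.
elim: k f => [|k IH] f loc; first by move=> x /loc[V' [_ V'x] cf]; exact: cf.
split=> [x /loc[V' [_ V'x] [df _]]|v]; first exact: df.
by apply: IH => x /loc[V' oV' [_ Df]]; exists V' => //; exact: Df.
Qed.

Lemma jacobian_cancel n n' (f : 'rV[R]_n -> 'rV[R]_n') (g : 'rV[R]_n' -> 'rV[R]_n) x :
  differentiable f x -> differentiable g (f x) -> (\forall y \near x, g (f y) = y) ->
  jacobian f x *m jacobian g (f x) = 1%:M.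
Proof.
move=> df dg gf; apply/row_matrixP => i; rewrite row_mul row1 rowE.
have dgf : differentiable (g \o f) x by exact: differentiable_comp.
have Did : 'D_(delta_mx 0 i) (g \o f) x = delta_mx 0 i.
  apply: etrans (near_eq_derive (g := id) _ _) _ => //.
  exact: derive_id.
apply: etrans _ Did; apply: esym; apply: etrans (deriveE _ dgf) _.
rewrite diff_comp //= -(deriveE _ df) -(deriveE _ dg).
by rewrite (deriveEjacobian _ dg) (deriveEjacobian _ df).
Qed.

(** A bracket at [x] differentiates only along the values of its arguments at [x], and these vanish
    by induction. *)
Lemma iterated_bracket_eq0 n (H : 'rV[R]_n -> 'M[R]_n) V X x : V x -> H x = 0 ->
  iterated_bracket H V X -> X x = 0.
Proof.
move=> Vx Hx; elim=> [{}X _ XH|{}X Y _ X0 _ Y0].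
  by apply/eqP; rewrite -submx0 -Hx; exact: XH.
by rewrite /lie_bracket X0 Y0 !derive0 subrr.
Qed.

Lemma bracket_generating_dim0 n (H : 'rV[R]_n -> 'M[R]_n) x :
  bracket_generating_at H x -> H x = 0 -> n = 0%N.
Proof.
move=> [V [[_ Vx] [r [X [itX fX]]]]] Hx; move: fX; rewrite /row_full.
suff -> : \matrix_i X i x = 0 by rewrite mxrank0 => /eqP.
by apply/row_matrixP => i; rewrite rowK row0; exact: iterated_bracket_eq0 (itX i).
Qed.

Lemma gram_regular n k (S : 'M[R]_n) (E : 'M[R]_(k, n)) : S^T = S ->
  (forall u : 'rV[R]_n, u *m S != 0 -> 0 < (u *m S *m u^T) 0 0) ->
  row_free E -> (E <= S)%MS -> (gram S E)^T = gram S E /\ posdef_mx (gram S E).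
Proof.
move=> Ss Spos fE /submxP[A EA]; rewrite EA gram_mulmx //; split.
  by rewrite !trmx_mul trmxK Ss mulmxA.
move=> w w0; have := Spos (w *m A); rewrite trmx_mul !mulmxA; apply.
apply: contra w0 => /eqP wE; apply/eqP; apply: (row_free_inj fE).
by rewrite mul0mx EA mulmxA.
Qed.

(** The bracket is antisymmetric, and the components are determined by it because the rows of [U]
    are independent modulo D. *)
Lemma levi_components_antisym n k m (H : 'rV[R]_n -> 'M[R]_n) x
    (E : 'rV[R]_n -> 'M[R]_(k, n)) (U : 'M[R]_(m, n)) L :
  adapted_frame H x E U -> levi_components H x E U L -> antisymmetric_levi L.
Proof.
move=> [[V [[_ Vx] _ /(_ x Vx)[_ EH]]] fEU _] lc a; apply/matrixP => i j.
suff : \row_b (L b j i + L b i j) = 0.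
  by move=> /rowP/(_ a); rewrite !mxE => /eqP; rewrite addr_eq0 => /eqP ->.
have := addmx_sub (lc j i) (lc i j).
rewrite [X in X - _ + _](_ : _ =
  - lie_bracket (fun y => row i (E y)) (fun y => row j (E y)) x); last first.
  by rewrite /lie_bracket opprB.
rewrite addrACA addNr add0r -opprD -big_split /=.
under eq_bigr => b _ do rewrite -scalerDl.
have -> : \sum_b (L b j i + L b i j) *: row b U = \row_b (L b j i + L b i j) *m U.
  by rewrite mulmx_sum_row; apply: eq_bigr => b _; rewrite mxE.
rewrite -(eqmxP EH) => /submxP[D DE].
have : row_mx D (\row_b (L b j i + L b i j)) *m col_mx (E x) U = 0.
  by rewrite mul_row_col -DE addNr.
rewrite -[X in _ = X](mul0mx _ (col_mx (E x) U)) => /(row_free_inj fEU).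
by move=> /(congr1 rsubmx); rewrite row_mxKr linear0.
Qed.

Section Structure.
Variable S : subRiemannian R.
Implicit Types (c : chart R S (Defs.dim S)).

Lemma sr_chart c : atlas c -> is_chart c.
Proof. by have [_ _ _ [ch _] _] := sr_manifold (sr_axioms S); exact: ch. Qed.

Lemma sr_pos c x (u : 'rV[R]_(Defs.dim S)) : atlas c -> cimg c x -> u *m sr_h c x != 0 ->
  0 < (u *m sr_h c x *m u^T) 0 0.
Proof.
move=> ac cx u0; have := sr_posdef (sr_axioms S) ac cx (submxMl u _) u0.
rewrite /hmetric trmx_mul (sr_sym (sr_axioms S) ac cx) mulmxA.
by rewrite mulmxKpV // submxMl.
Qed.

Definition regular_structure : Prop :=
  forall c x, atlas c -> cimg c x -> regular_at (sr_h c) x.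

Lemma regular_structureP :
  levi_surjective S -> bundle_map_injective S -> regular_structure.
Proof.
move=> surj inj c x ac cx; have [_ oc _ _ _] := sr_chart ac.
apply: (@regular_at_frames _ _ _ (cimg c)) => //.
- exact: (sr_tensor (sr_axioms S)).1.
- by move=> y cy; exact: (sr_sym (sr_axioms S) ac cy).
- by move=> y cy; rewrite !(sr_const_rank (sr_axioms S) ac).
- by move=> u; exact: sr_pos.
- by move=> k m E U L aF lc; split; [exact: surj aF lc|exact: inj aF lc].
Qed.

(** Collects what the geometry guarantees about the components in any adapted frame, so that the
    contact and free cases become pure algebra. *)
Lemma fibrewise_impl (P Q : forall k m, 'M[R]_k -> ('I_m -> 'I_k -> 'I_k -> R) -> Prop) :
  (forall c x k m (hD : 'M[R]_k) (L : 'I_m -> 'I_k -> 'I_k -> R), atlas c -> cimg c x ->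
    \rank (sr_h c x) = k -> (k + m)%N = Defs.dim S ->
    hD^T = hD -> posdef_mx hD -> antisymmetric_levi L -> P k m hD L -> Q k m hD L) ->
  fibrewise S P -> fibrewise S Q.
Proof.
move=> PQ SP c x ac cx k m E U L aF lc; have [[V [[_ Vx] _ /(_ x Vx)[fE EH]]] _ kmn] := aF.
have Hs := sr_sym (sr_axioms S) ac cx.
have /andP[EH1 _] := EH; have [|hDs hDp] := gram_regular Hs _ fE EH1.
  by move=> u; exact: sr_pos.
apply: (PQ c x) => //; last exact: SP aF lc.
- by rewrite -(eqmxP EH); apply/eqP.
- exact: levi_components_antisym aF lc.
Qed.

Lemma contact_regular : contact S -> levi_surjective S /\ bundle_map_injective S.
Proof.
move=> cS.
have H : fibrewise S (fun k m hD L => @levi_surjective_frame R k m hD L /\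
    @bundle_map_injective_frame R k m hD L).
  apply: fibrewise_impl cS => c x k m hD L ac cx rk kmn hDs hDp La cf.
  have m1 : m = 1%N by case: cf.
  (* Nondegeneracy is vacuous for k = 0. That case is excluded by bracket generation: a zero
     distribution generates only in dimension 0, and here the dimension would be 1. *)
  subst m; apply: contact_frame_regular => //; rewrite lt0n; apply/eqP => k0.
  have Hx : sr_h c x = 0 by apply/eqP; rewrite -mxrank_eq0 rk k0.
  have := bracket_generating_dim0 (sr_generating (sr_axioms S) ac cx) Hx.
  by rewrite -kmn k0.
split=> c x ac cx k m E U L aF lc; by have [] := H c x ac cx k m E U L aF lc.
Qed.

Lemma free_regular : free_distribution S -> sr_rank S <> 3%N ->
  levi_surjective S /\ bundle_map_injective S.
Proof.
move=> fS r3; split; apply: fibrewise_impl fS => c x k m hD L ac cx rk kmn hDs hDp La ff.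
  exact: free_frame_surjective ff.
apply: free_frame_injective => //.
by rewrite -rk (sr_const_rank (sr_axioms S) ac cx).
Qed.

(** A pointwise choice, harmless because the matrix is unique for regular structures; the default 0
    is taken where none exists. *)
Definition canonical_metric : tensor2 S :=
  fun c x => xget 0 [set G | canonical_at (sr_h c) x G].

Lemma canonical_metricP c x : regular_structure -> atlas c -> cimg c x ->
  exists W, [/\ open_nbhs x W, smooth_on W (canonical_metric c) & forall y, W y ->
    [/\ canonical_at (sr_h c) y (canonical_metric c y),
        (canonical_metric c y)^T = canonical_metric c y, posdef_mx (canonical_metric c y)
      & sr_h c y *m canonical_metric c y *m sr_h c y = sr_h c y]].
Proof.
move=> reg ac cx; have [_ oc _ _ _] := sr_chart ac.
have sH : smooth_on (cimg c) (sr_h c) by exact: (sr_tensor (sr_axioms S)).1.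
have Hs y : cimg c y -> (sr_h c y)^T = sr_h c y.
  by move=> cy; exact: (sr_sym (sr_axioms S) ac cy).
have [|||W [G [[oW Wx] sG GP]]] := @canonical_exists R _ (sr_h c) (cimg c) x (conj oc cx) sH Hs.
- by move=> y cy; rewrite !(sr_const_rank (sr_axioms S) ac).
- by move=> y u cy; exact: sr_pos.
- by move=> y cy; exact: reg.
exists (W `&` cimg c).
have oWc : open (W `&` cimg c) by exact: openI.
have gE y : (W `&` cimg c) y -> G y = canonical_metric c y.
  move=> [Wy cy]; have [Gy _ _ _] := GP _ Wy.
  apply: (canonical_at_unique (conj oc cy) Hs sH (reg _ _ ac cy) Gy).
  exact: (xgetPex 0 (ex_intro (canonical_at (sr_h c) y) _ Gy)).
split=> //; first by move=> k; apply: (Ck_on_eq oWc gE); apply: Ck_on_subset (sG k) => y [].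
by move=> y Wy; rewrite -gE //; apply: GP; case: Wy.
Qed.

End Structure.

Lemma canonical_metric_natural (S S' : subRiemannian R) (F : S -> S') :
  regular_structure S -> regular_structure S' -> open_embedding F ->
  contra_related F (@sr_h R S) (@sr_h R S') ->
  is_pullback F (@canonical_metric S) (@canonical_metric S').
Proof.
move=> reg reg' [[cF sF] oF [Gi [GK [cG sG]]]] rel c d p ac ad cp dp J.
have [odc occ cK cmc ccc] := sr_chart ac; have [odd ocd dK cmd ccd] := sr_chart ad.
set f := local_rep c d F in J *.
pose V := cmap c @` (setT `&` cdom c `&` F @^-1` cdom d).
have VE : V = cimg c `&` (F \o cinv c) @^-1` cdom d.
  apply/seteqP; split=> y.
    by move=> [q [[_ cq] dq] <-]; split; [exists q|rewrite /= cK].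
  by move=> [[q cq <-]] /=; rewrite cK // => dq; exists q.
have oV : open V.
  rewrite VE; apply: open_preimage => // y cy.
  by apply: continuous_comp; [exact: ccc|exact: cF].
have Vx : V (cmap c p) by exists p.
have sf : smooth_on V f by exact: sF.
have fE q : cdom c q -> f (cmap c q) = cmap d (F q) by move=> cq; rewrite /f /local_rep /= cK.
(* The local inverse of [f]; its smoothness makes the Jacobian of [f] invertible, as
   [canonical_at_pullback] requires. *)
set e := local_rep d c Gi.
pose V1 := cmap d @` (range F `&` cdom d `&` Gi @^-1` cdom c).
have se : smooth_on V1 e by exact: sG.
have V1E : V1 = cimg d `&` (cinv d) @^-1` (range F `&` Gi @^-1` cdom c).
  apply/seteqP; split=> y.
    by move=> [q [[rq dq] cq] <-]; split; [exists q|rewrite /= dK].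
  by move=> [[q dq <-]] /=; rewrite dK // => -[rq cq]; exists q.
have oV1 : open V1.
  rewrite V1E; apply: open_preimage => //.
  exact: open_preimage.
have ef y : V y -> e (f y) = y.
  by move=> [q [[_ cq] dq] <-]; rewrite fE // /e /local_rep /= dK // GK.
have V1f y : V y -> V1 (f y).
  move=> [q [[_ cq] dq] <-]; rewrite fE //; exists (F q) => //.
  by split; [split; [exists q|]|rewrite /= GK].
have fe z : V1 z -> f (e z) = z.
  move=> [_ [[[q _ <-] dq] cq] <-]; move: cq; rewrite /= GK => cq.
  by rewrite /e /local_rep /= dK // GK fE.
have invJ y : V y -> exists J', jacobian f y *m J' = 1%:M /\ J' *m jacobian f y = 1%:M.
  move=> Vy; have df := smooth_differentiable sf Vy.
  have de := smooth_differentiable se (V1f _ Vy).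
  exists (jacobian e (f y)); split.
    apply: jacobian_cancel => //; near=> z; apply: ef; near: z.
    exact: open_nbhs_nbhs.
  rewrite -{2}(ef _ Vy); apply: jacobian_cancel => //; first by rewrite ef.
  near=> z; apply: fe; near: z; apply: open_nbhs_nbhs; split=> //.
  exact: V1f.
have cx : cimg c (cmap c p) by exists p.
have dx : cimg d (cmap d (F p)) by exists (F p).
have sH : smooth_on (cimg c) (sr_h c) by exact: (sr_tensor (sr_axioms S)).1.
have Hs y : cimg c y -> (sr_h c y)^T = sr_h c y.
  by move=> cy; exact: (sr_sym (sr_axioms S) ac cy).
have [W [[_ Wx] _ /(_ _ Wx)[gx _ _ _]]] := canonical_metricP reg ac cx.
have [W' [[_ Wx'] _ /(_ _ Wx')[gx' _ _ _]]] := canonical_metricP reg' ad dx.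
apply: (canonical_at_unique (conj occ cx) Hs sH (reg _ _ ac cx) gx).
apply: (@canonical_at_pullback R _ _ (sr_h c) (sr_h d) f V (cimg d)) => //.
- by move=> y [q [[_ cq] dq] <-]; rewrite fE //; exists (F q).
- exact: (sr_tensor (sr_axioms S')).1.
- by move=> y; rewrite VE => -[/Hs].
- by move=> y [q [[_ cq] dq] <-]; rewrite fE //; exact: rel.
- by rewrite fE.
Unshelve. all: by end_near. Qed.

Lemma canonical_metric_canonical (C : subRiemannian R -> Prop) :
  (forall S, C S -> levi_surjective S /\ bundle_map_injective S) ->
  canonical_extension C (@canonical_metric).
Proof.
move=> CP; have reg S : C S -> regular_structure S.
  by move=> /CP[]; exact: regular_structureP.
split=> [S /reg rS|S S' F /reg rS /reg rS']; last exact: canonical_metric_natural.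
split; last first.
  move=> c x X Y ac cx /submxP[A ->] /submxP[B ->].
  have [W [[_ Wx] _ /(_ _ Wx)[_ _ _ HGH]]] := canonical_metricP rS ac cx.
  have Hs := sr_sym (sr_axioms S) ac cx.
  have -> : hmetric (sr_h c x) (A *m sr_h c x) (B *m sr_h c x) = (A *m sr_h c x *m B^T) 0 0.
    by rewrite /hmetric trmx_mul Hs mulmxA mulmxKpV // submxMl.
  by rewrite trmx_mul Hs -[in RHS]HGH !mulmxA.
split; last first.
  move=> c x ac cx.
  by have [W [[_ Wx] _ /(_ _ Wx)[_ gs gp _]]] := canonical_metricP rS ac cx; split.
split=> [c ac k|].
  apply: Ck_on_local => x cx.
  by have [W [oW sg _]] := canonical_metricP rS ac cx; exists W.
have [_ _ _ _ sid] := sr_manifold (sr_axioms S).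
(* Naturality along the identity is the transformation law under changes of chart. *)
apply: canonical_metric_natural => //; last exact: (sr_tensor (sr_axioms S)).2.
have rT : range (@idfun S) = setT by apply/seteqP; split=> // y _; exists y.
by split; rewrite ?rT //; [exact: openT|exists idfun; rewrite ?rT].
Qed.

End Assembly.

Theorem theorem12 (R : realType) :
  exists g : forall S : subRiemannian R, tensor2 S,
    [/\ canonical_extension
          (fun S => levi_surjective S /\ bundle_map_injective S) g,
        canonical_extension (fun S => contact S) g
      & canonical_extension
          (fun S => free_distribution S /\ sr_rank S <> 3%N) g].
Proof.
exists (@canonical_metric R); split; apply: canonical_metric_canonical => S //.
  exact: contact_regular.
by case; exact: free_regular.
Qed.
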